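(* Let $0<\epsilon<0.01$ be a constant. For $x$ sufficiently large and $N$ an $(l,x)$-factorable number with \[ \frac{x}{(\log x)^{C_0+100}}\le l\le \frac{x}{(\log x)^{C_0+10}}, \] we have \[ \textsf{r}^{\mathbb{C}}_{\mathrm{DFT}_N}\left(\frac{N}{\exp\left(\epsilon^6(\log N)^{0.36}\right)}\right)\le N^{7\epsilon}. \]
   Context: Let $C$ be an absolute constant such that (by a theorem of Baker and Harman) there is $x_0$ with: for all $x>x_0$ and $y\ge x^{0.2961}$, the number of primes $p\le x$ such that every prime factor of $p-1$ is at most $y$ exceeds $x/(\log x)^C$. Set $C_0=C+1$. A prime $q$ is $x$-good if $x/(\log x)^{C_0}\le q\le x$ and every prime power dividing $q-1$ is at most $x^{0.3}$. An integer $N$ is $(l,x)$-factorable if $N=q_1\cdots q_l$ for distinct $x$-good primes $q_1,\dots,q_l$. $\mathrm{DFT}_N$ is the $N\times N$ complex matrix with entries $\omega^{xy}$, $0\le x,y\le N-1$, $\omega=e^{2\pi i/N}$. $\textsf{r}^{\mathbb{F}}_M(r)$ is the smallest $s$ such that $M=A+B$ over $\mathbb{F}$ with $A$ having at most $s$ nonzero entries in each row and column and $\operatorname{rank}(B)\le r$. *)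

(* Defs.v *)
From HB Require Import structures.
From mathcomp Require Import all_boot all_order all_algebra.
From mathcomp Require Import complex.
From mathcomp Require Import boolp reals sequences exp trigo.

Set Implicit Arguments.
Unset Strict Implicit.
Unset Printing Implicit Defensive.

Import Order.TTheory GRing.Theory Num.Theory.
Local Open Scope ring_scope.
Local Open Scope complex_scope.

Section NumberTheory.
Variable R : realType.
Implicit Types x y C : R.

(* The iota bound only makes the list finite: for x >= 0, an integer p
   satisfies p <= x exactly when p <= truncn x. *)
Definition smooth_prime_count x y : nat :=
  count (fun p : nat => prime p && all (fun q : nat => q%:R <= y) (primes (p - 1)))
        (iota 0 (Num.truncn x).+1).

Definition baker_harman_constant C : Prop :=
  exists x0 : R, forall x y, x0 < x -> x `^ (2961%:R / 10%:R ^+ 4) <= y ->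
    x / (ln x) `^ C < (smooth_prime_count x y)%:R.

Definition C0 C : R := C + 1.

Definition good_prime C x (q : nat) : Prop :=
  [/\ prime q,
      x / (ln x) `^ (C0 C) <= q%:R,
      q%:R <= x
    & forall p k : nat, prime p -> (0 < k)%N -> (p ^ k %| q - 1)%N ->
        (p ^ k)%:R <= x `^ (3%:R / 10%:R)].

Definition factorable C (l : nat) x (N : nat) : Prop :=
  exists qs : seq nat,
    [/\ uniq qs, size qs = l,
        (forall q, q \in qs -> good_prime C x q)
      & N = (\prod_(q <- qs) q)%N].

End NumberTheory.

Definition dft_root (R : realType) (N : nat) : R[i] :=
  cos (2%:R * pi / N%:R) +i* sin (2%:R * pi / N%:R).

Definition DFT (R : realType) (N : nat) : 'M[R[i]]_N :=
  \matrix_(x < N, y < N) dft_root R N ^+ (nat_of_ord x * nat_of_ord y)%N.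

Section Rigidity.
Variables (R : realType) (F : fieldType) (n : nat).
Implicit Types (M A B : 'M[F]_n) (r : R) (s : nat).

Definition row_col_sparse A s : Prop :=
  (forall i, (#|[set j | A i j != 0%R]| <= s)%N) /\
  (forall j, (#|[set i | A i j != 0%R]| <= s)%N).

Definition sparse_plus_low_rank M r s : Prop :=
  exists A B, [/\ M = A + B, row_col_sparse A s & (\rank B)%:R <= r].

(* The rank bound r is real, so that r = N / exp(...) needs no rounding.
   The else branch is only reached for r < 0, see rigidityP. *)
Definition rigidity M r : nat :=
  if pselect (exists s, `[< sparse_plus_low_rank M r s >]) is left exs
  then ex_minn exs else n.

Lemma rigidityP M r : 0 <= r ->
  sparse_plus_low_rank M r (rigidity M r) /\
  forall s, sparse_plus_low_rank M r s -> (rigidity M r <= s)%N.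
Proof.
move=> r0; rewrite /rigidity; case: pselect => [exs|[]].
  case: ex_minnP => s /asboolP Ps smin; split=> // t Pt.
  by apply: smin; apply/asboolP.
exists n; apply/asboolP; exists M, 0; split; rewrite ?addr0 ?mxrank0//.
by split=> i; rewrite -[leqRHS]card_ord max_card.
Qed.

End Rigidity.

(* Main.v *)
Require Import Defs.
From HB Require Import structures.
From mathcomp Require Import all_boot all_order all_algebra cyclic finfield.
From mathcomp Require Import complex.
From mathcomp Require Import boolp reals sequences exp trigo.
From mathcomp Require Import ring lra zify.
Import Order.TTheory GRing.Theory Num.Theory.
Local Open Scope ring_scope.

Set Implicit Arguments.
Unset Strict Implicit.
Unset Printing Implicit Defensive.

(* By the Chinese remainder theorem DFT_N is, up to relabelling, the tensor product of the
   DFT_q over the primes q dividing N. Split DFT_q into its block on nonzero indices and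
   the rank-2 cross formed by row 0 and column 0, and expand. Terms with at least
   m = x^0.37 crosses have small total rank because N has few prime factors compared with
   the size of each; in the other terms the crosses are simply counted as dense.
   Discrete logarithms turn the block on nonzero indices into f(i + j) on Z/(q-1), which
   Fourier analysis factors as G * diagonal * G^T with G a copy of DFT_(q-1), and this is
   again a tensor product of DFT_d over the prime powers d <= x^0.3 exactly dividing q - 1.
   A prime power d occurring n < x^0.69 times is counted as dense, which is affordable as
   there are at most x^0.3 values of d. If n >= x^0.69, the matrix DFT_d^(tensor n) is,
   up to diagonal scaling, f(x + y) with f symmetric under permuting coordinates, and a
   correction of f on vectors of small weight makes its Fourier transform vanish
   wherever all letter counts are within a factor 1 +- x^(-0.005) of n / d; the
   exceptional frequencies form a fraction about exp(-n / (d x^0.01)) of all. *)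

(** * Sums of a sparse and a low-rank kernel *)

Section SparseLowRank.
Variables (R : realFieldType) (F : fieldType).

Definition sparse (I J : finType) (A : I -> J -> F) (n : nat) : Prop :=
  (forall x, (#|[set y | A x y != 0%R]| <= n)%N) /\
  (forall y, (#|[set x | A x y != 0%R]| <= n)%N).

(** The rank is witnessed by a factorization through a finite type and measured as a fraction [rho]
    of the number of rows: under tensor products fractions add and sparsities multiply, whatever the
    sizes. *)
Definition slr (I J : finType) (K : I -> J -> F) (rho s : R) : Prop :=
  exists (A : I -> J -> F) (n : nat) (T : finType) (u : I -> T -> F) (v : T -> J -> F),
  [/\ forall x y, K x y = A x y + \sum_t u x t * v t y,
      sparse A n, n%:R <= s & #|T|%:R <= rho * #|I|%:R].

Definition tens (I1 J1 I2 J2 : finType) (K1 : I1 -> J1 -> F) (K2 : I2 -> J2 -> F)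
  (x : I1 * I2) (y : J1 * J2) : F := K1 x.1 y.1 * K2 x.2 y.2.

Lemma slr_weaken (I J : finType) (K : I -> J -> F) (r r' s s' : R) :
  r <= r' -> s <= s' -> slr K r s -> slr K r' s'.
Proof.
move=> rr ss [A [n [T [u [v [HK Hs Hn HT]]]]]].
exists A, n, T, u, v; split=> //; first exact: le_trans ss.
by apply: (le_trans HT); rewrite ler_wpM2r.
Qed.

Lemma slr_ext (I J : finType) (K K' : I -> J -> F) (r s : R) :
  (forall x y, K x y = K' x y) -> slr K r s -> slr K' r s.
Proof.
move=> E [A [n [T [u [v [HK Hs Hn HT]]]]]].
by exists A, n, T, u, v; split=> // x y; rewrite -E.
Qed.

Lemma sparse0 (I J : finType) n : sparse (fun (_ : I) (_ : J) => 0) n.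
Proof.
by split=> z; rewrite (_ : [set _ | _] = set0) ?cards0//; apply/setP=> i; rewrite !inE eqxx.
Qed.

Lemma slr_low_rank (I J T : finType) (K : I -> J -> F) (u : I -> T -> F) (v : T -> J -> F)
    (r : R) :
  (forall x y, K x y = \sum_t u x t * v t y) -> #|T|%:R <= r * #|I|%:R -> slr K r 0.
Proof.
move=> HK HT; exists (fun _ _ => 0), 0%N, T, u, v; split=> //; last exact: sparse0.
by move=> x y; rewrite add0r.
Qed.

Lemma slr_sparse (I J : finType) (K : I -> J -> F) (n : nat) (s : R) :
  sparse K n -> n%:R <= s -> slr K 0 s.
Proof.
move=> Hs Hn; exists K, n, void, (fun _ _ => 0), (fun _ _ => 0); split=> //.
  by move=> x y; rewrite big1 ?addr0// => i _; rewrite mul0r.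
by rewrite card_void mul0r.
Qed.

Lemma slr_trivial (I : finType) (K : I -> I -> F) : slr K 0 #|I|%:R.
Proof. by apply: (@slr_sparse _ _ _ #|I|) => //; split=> z; apply: max_card. Qed.

Lemma slr_add {I J : finType} {K1 K2 : I -> J -> F} {r1 s1 r2 s2 : R} :
  slr K1 r1 s1 -> slr K2 r2 s2 -> slr (fun x y => K1 x y + K2 x y) (r1 + r2) (s1 + s2).
Proof.
move=> [A1 [n1 [T1 [u1 [v1 [HK1 [Hr1 Hc1] Hn1 HT1]]]]]].
move=> [A2 [n2 [T2 [u2 [v2 [HK2 [Hr2 Hc2] Hn2 HT2]]]]]].
exists (fun x y => A1 x y + A2 x y), (n1 + n2)%N, (T1 + T2)%type,
  (fun x t => match t with inl t => u1 x t | inr t => u2 x t end),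
  (fun t y => match t with inl t => v1 t y | inr t => v2 t y end).
split.
- by move=> x y; rewrite big_sumType/= HK1 HK2; ring.
- split=> z.
    apply: leq_trans (leq_add (Hr1 z) (Hr2 z)).
    apply: leq_trans (leq_card_setU _ _); apply/subset_leq_card/subsetP=> i.
    by rewrite !inE -negb_and; apply: contra => /andP[/eqP-> /eqP->]; rewrite addr0.
  apply: leq_trans (leq_add (Hc1 z) (Hc2 z)).
  apply: leq_trans (leq_card_setU _ _); apply/subset_leq_card/subsetP=> i.
  by rewrite !inE -negb_and; apply: contra => /andP[/eqP-> /eqP->]; rewrite addr0.
- by rewrite natrD lerD.
- by rewrite card_sum natrD mulrDl lerD.
Qed.

Lemma slr_full_rank (I J : finType) (K : I -> J -> F) : slr K 1 0.
Proof.
apply: (@slr_low_rank _ _ I _ (fun x t => (t == x)%:R) K); last by rewrite mul1r.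
move=> x y; rewrite (bigD1 x)//= eqxx mul1r big1 ?addr0// => t /negPf->.
by rewrite mul0r.
Qed.

(** The fraction refers to the rows, which become the columns; hence the comparison of [#|I|] with
    [#|J|]. *)
Lemma slr_tr (I J : finType) (K : I -> J -> F) (r s : R) : (#|I| <= #|J|)%N -> 0 <= r ->
  slr K r s -> slr (fun y x => K x y) r s.
Proof.
move=> cIJ r0 [A [n [T [u [v [HK [Hr Hc] Hn HT]]]]]].
exists (fun y x => A x y), n, T, (fun y t => v t y), (fun t x => u x t); split=> //.
  by move=> y x; rewrite HK; congr (_ + _); apply: eq_bigr => t _; rewrite mulrC.
by apply: (le_trans HT); rewrite ler_wpM2l// ler_nat.
Qed.

Lemma slr_scale (I J : finType) (K : I -> J -> F) (a : I -> F) (b : J -> F) (r s : R) :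
  slr K r s -> slr (fun x y => a x * K x y * b y) r s.
Proof.
move=> [A [n [T [u [v [HK [Hr Hc] Hn HT]]]]]].
exists (fun x y => a x * A x y * b y), n, T, (fun x t => a x * u x t),
  (fun t y => v t y * b y); split=> //.
  move=> x y; rewrite HK mulrDr mulrDl; congr (_ + _).
  by rewrite mulr_sumr mulr_suml; apply: eq_bigr => t _; ring.
split=> z; [apply: leq_trans (Hr z) | apply: leq_trans (Hc z)];
  apply/subset_leq_card/subsetP=> i; rewrite !inE;
  by apply: contra => /eqP->; rewrite mulr0 mul0r.
Qed.

(** With L1, L2 the low-rank parts, K1 (x) K2 = L1 (x) K2 + A1 (x) L2 + A1 (x) A2; leaving [K2]
    whole in the first term keeps its rank at |T1| |I2|. *)
Lemma slr_tens {I1 J1 I2 J2 : finType} {K1 : I1 -> J1 -> F} {K2 : I2 -> J2 -> F}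
    {r1 s1 r2 s2 : R} :
  slr K1 r1 s1 -> slr K2 r2 s2 -> slr (tens K1 K2) (r1 + r2) (s1 * s2).
Proof.
move=> [A1 [n1 [T1 [u1 [v1 [HK1 [Hr1 Hc1] Hn1 HT1]]]]]].
move=> [A2 [n2 [T2 [u2 [v2 [HK2 [Hr2 Hc2] Hn2 HT2]]]]]].
exists (tens A1 A2), (n1 * n2)%N, (T1 * I2 + I1 * T2)%type,
  (fun x t => match t with
   | inl p => if p.2 == x.2 then u1 x.1 p.1 else 0
   | inr p => if p.1 == x.1 then u2 x.2 p.2 else 0 end),
  (fun t y => match t with
   | inl p => v1 p.1 y.1 * K2 p.2 y.2
   | inr p => A1 p.1 y.1 * v2 p.2 y.2 end).
split.
- move=> [x1 x2] [y1 y2]; rewrite big_sumType/= /tens/=.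
  rewrite -(pair_bigA _ (fun t i => (if i == x2 then u1 x1 t else 0) * (v1 t y1 * K2 i y2)))/=.
  rewrite -(pair_bigA _ (fun i t => (if i == x1 then u2 x2 t else 0) * (A1 i y1 * v2 t y2)))/=.
  have -> : \sum_t \sum_i (if i == x2 then u1 x1 t else 0) * (v1 t y1 * K2 i y2)
      = (\sum_t u1 x1 t * v1 t y1) * K2 x2 y2.
    rewrite mulr_suml; apply: eq_bigr => t _.
    rewrite (bigD1 x2)//= eqxx big1 ?addr0 ?mulrA// => i /negPf->; exact: mul0r.
  rewrite (bigD1 x1)//= eqxx [X in _ + (_ + (_ + X))]big1 ?addr0; last first.
    by move=> i /negPf E; rewrite big1// => t _; rewrite E mul0r.
  have -> : \sum_t u2 x2 t * (A1 x1 y1 * v2 t y2) = A1 x1 y1 * (\sum_t u2 x2 t * v2 t y2).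
    by rewrite mulr_sumr; apply: eq_bigr => t _; ring.
  by rewrite HK1 HK2; ring.
- split=> [[z1 z2]|[z1 z2]].
    apply: leq_trans (leq_mul (Hr1 z1) (Hr2 z2)); rewrite -cardsX.
    apply/subset_leq_card/subsetP=> -[i1 i2]; rewrite !inE /tens/=.
    by rewrite mulf_eq0 negb_or.
  apply: leq_trans (leq_mul (Hc1 z1) (Hc2 z2)); rewrite -cardsX.
  apply/subset_leq_card/subsetP=> -[i1 i2]; rewrite !inE /tens/=.
  by rewrite mulf_eq0 negb_or.
- by rewrite natrM ler_pM.
- rewrite card_sum !card_prod natrD !natrM.
  rewrite mulrDl lerD//; first by rewrite mulrA ler_wpM2r.
  by rewrite mulrC [_%:R * #|I2|%:R]mulrC mulrA ler_wpM2r.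
Qed.

(** Sparsity 0 makes the sparse parts vanish, so both kernels are purely low rank and the fractions
    multiply instead of adding. *)
Lemma slr_tens_low_rank {I1 J1 I2 J2 : finType} {K1 : I1 -> J1 -> F} {K2 : I2 -> J2 -> F}
    {r1 r2 : R} :
  slr K1 r1 0 -> slr K2 r2 0 -> slr (tens K1 K2) (r1 * r2) 0.
Proof.
have low (I J : finType) (K : I -> J -> F) r : slr K r 0 ->
    exists (T : finType) (u : I -> T -> F) (v : T -> J -> F),
    (forall x y, K x y = \sum_t u x t * v t y) /\ #|T|%:R <= r * #|I|%:R.
  move=> [A [n [T [u [v [HK [Hr _] Hn HT]]]]]]; exists T, u, v; split=> // x y.
  rewrite HK; have [->|nz] := eqVneq (A x y) 0; first by rewrite add0r.
  move: Hn; rewrite lern0 => /eqP n0; move: (Hr x).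
  by rewrite n0 leqn0 cards_eq0 => /eqP/setP/(_ y); rewrite !inE nz.
move=> /low [T1 [u1 [v1 [HK1 HT1]]]] /low [T2 [u2 [v2 [HK2 HT2]]]].
apply: (@slr_low_rank _ _ (T1 * T2)%type _ (fun x t => u1 x.1 t.1 * u2 x.2 t.2)
   (fun t y => v1 t.1 y.1 * v2 t.2 y.2)).
  move=> [x1 x2] [y1 y2]; rewrite /tens/= HK1 HK2 big_distrlr/= pair_bigA/=.
  by apply: eq_bigr => -[t1 t2] _ /=; ring.
rewrite !card_prod !natrM mulrACA ler_pM//.
Qed.

(** As for tensor products, K1 K2 = L1 K2 + A1 L2 + A1 A2. The rank of L2 is a fraction of |J|,
    which has to be charged to |I|. *)
Lemma slr_mul {I J L : finType} {K1 : I -> J -> F} {K2 : J -> L -> F} {r1 s1 r2 s2 : R} :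
  (#|J| <= #|I|)%N -> 0 <= r2 -> slr K1 r1 s1 -> slr K2 r2 s2 ->
  slr (fun x y => \sum_z K1 x z * K2 z y) (r1 + r2) (s1 * s2).
Proof.
move=> cIJ r2_ge0.
move=> [A1 [n1 [T1 [u1 [v1 [HK1 [Hr1 Hc1] Hn1 HT1]]]]]].
move=> [A2 [n2 [T2 [u2 [v2 [HK2 [Hr2 Hc2] Hn2 HT2]]]]]].
exists (fun x y => \sum_z A1 x z * A2 z y), (n1 * n2)%N, (T1 + T2)%type,
  (fun x t => match t with inl t => u1 x t | inr t => \sum_z A1 x z * u2 z t end),
  (fun t y => match t with inl t => \sum_z v1 t z * K2 z y | inr t => v2 t y end).
have nz (I' J' : finType) (B : {set I'}) (C : I' -> {set J'}) n n' :
    (#|B| <= n)%N -> (forall b, (#|C b| <= n')%N) -> (#|\bigcup_(b in B) C b| <= n * n')%N.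
  move=> hB hC; apply: (@leq_trans (\sum_(b in B) #|C b|)).
    elim/big_rec2: _ => [|b k S _ IH]; first by rewrite cards0.
    by apply: leq_trans (leq_card_setU _ _) _; rewrite leq_add2l.
  apply: (@leq_trans (\sum_(b in B) n')); first exact: leq_sum.
  by rewrite sum_nat_const leq_mul2r hB orbT.
split.
- move=> x y; rewrite big_sumType/=.
  have -> : \sum_i u1 x i * (\sum_z v1 i z * K2 z y) = \sum_z (\sum_i u1 x i * v1 i z) * K2 z y.
    under eq_bigr do rewrite mulr_sumr.
    rewrite exchange_big; apply: eq_bigr => z _; rewrite mulr_suml.
    by apply: eq_bigr => i _; rewrite mulrA.
  have -> : \sum_i (\sum_z A1 x z * u2 z i) * v2 i y = \sum_z A1 x z * (\sum_i u2 z i * v2 i y).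
    under eq_bigr do rewrite mulr_suml.
    rewrite exchange_big; apply: eq_bigr => z _; rewrite mulr_sumr.
    by apply: eq_bigr => i _; rewrite mulrA.
  rewrite -!big_split; apply: eq_bigr => z _ /=; rewrite HK1 HK2; ring.
- split=> [x|y].
    apply: leq_trans (nz _ _ [set z | A1 x z != 0%R] (fun z => [set y | A2 z y != 0%R])
      _ _ (Hr1 x) Hr2).
    apply/subset_leq_card/subsetP=> y; rewrite inE => nz0; apply/bigcupP.
    have [z hz|no] := pickP (fun z => (A1 x z != 0%R) && (A2 z y != 0%R)).
      by case/andP: hz => h1 h2; exists z; rewrite inE.
    case/eqP: nz0; rewrite big1// => z _; apply/eqP; rewrite mulf_eq0.
    by move: (no z); rewrite -negb_or => /negbFE.
  rewrite mulnC.
  apply: leq_trans (nz _ _ [set z | A2 z y != 0%R] (fun z => [set x | A1 x z != 0%R])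
    _ _ (Hc2 y) Hc1).
  apply/subset_leq_card/subsetP=> x; rewrite inE => nz0; apply/bigcupP.
  have [z hz|no] := pickP (fun z => (A1 x z != 0%R) && (A2 z y != 0%R)).
    by case/andP: hz => h1 h2; exists z; rewrite inE.
  case/eqP: nz0; rewrite big1// => z _; apply/eqP; rewrite mulf_eq0.
  by move: (no z); rewrite -negb_or => /negbFE.
- by rewrite natrM ler_pM.
- rewrite card_sum natrD mulrDl lerD//; apply: (le_trans HT2).
  by rewrite ler_wpM2l// ler_nat.
Qed.

(** * Submatrices and relabellings *)

Definition pinj (A B : Type) (f : A -> option B) : Prop :=
  forall x y, f x = f y -> f x <> None -> x = y.

(* Up to a relabelling of rows and columns, K is a submatrix of K' bordered by zeros. *)
Definition emb {I J I' J' : finType} (K : I -> J -> F) (K' : I' -> J' -> F) : Prop :=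
  exists (f : I -> option I') (g : J -> option J'),
  [/\ pinj f, pinj g & forall x y, K x y =
    match f x, g y with Some a, Some b => K' a b | _, _ => 0 end].

Lemma emb_inj {I J I' J' : finType} {K : I -> J -> F} {K' : I' -> J' -> F}
    (f : I -> I') (g : J -> J') :
  injective f -> injective g -> (forall x y, K x y = K' (f x) (g y)) -> emb K K'.
Proof.
move=> fi gi H; exists (fun x => Some (f x)), (fun y => Some (g y)); split=> //.
  by move=> x y [] /fi.
by move=> x y [] /gi.
Qed.

Arguments emb_inj {I J I' J' K K'} f g.

Lemma emb_trans {I J I' J' I'' J'' : finType} {K : I -> J -> F} {K' : I' -> J' -> F}
  {K'' : I'' -> J'' -> F} : emb K K' -> emb K' K'' -> emb K K''.
Proof.
move=> [f [g [fi gi H]]] [f' [g' [fi' gi' H']]].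
have comp (A B C : finType) (h : A -> option B) (h' : B -> option C) :
    pinj h -> pinj h' -> pinj (fun x => obind h' (h x)).
  move=> hi hi' x y; case Ex: (h x) => [a|]//=; case Ey: (h y) => [b|]/=; last by move=> ->.
  move=> E nn; have ab : a = b by apply: hi'.
  by apply: hi; rewrite Ex ?Ey ?ab.
exists (fun x => obind f' (f x)), (fun y => obind g' (g y)); split; try exact: comp.
move=> x y; rewrite H; case: (f x) => [a|]//; case: (g y) => [b|]//=.
by case: (f' a).
Qed.

Lemma emb_tens {I1 J1 I1' J1' I2 J2 I2' J2' : finType} {K1 : I1 -> J1 -> F}
  {K1' : I1' -> J1' -> F} {K2 : I2 -> J2 -> F} {K2' : I2' -> J2' -> F} :
  emb K1 K1' -> emb K2 K2' -> emb (tens K1 K2) (tens K1' K2').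
Proof.
move=> [f1 [g1 [fi1 gi1 H1]]] [f2 [g2 [fi2 gi2 H2]]].
pose h (A1 A2 B1 B2 : finType) (h1 : A1 -> option B1) (h2 : A2 -> option B2) (x : A1 * A2) :=
  if h1 x.1 is Some a then if h2 x.2 is Some b then Some (a, b) else None else None.
have hi (A1 A2 B1 B2 : finType) (h1 : A1 -> option B1) (h2 : A2 -> option B2) :
    pinj h1 -> pinj h2 -> pinj (h _ _ _ _ h1 h2).
  move=> i1 i2 [x1 x2] [y1 y2]; rewrite /h/=.
  case E1: (h1 x1) => [a|]//; case E2: (h2 x2) => [b|]//.
  case E1': (h1 y1) => [a'|]//; case E2': (h2 y2) => [b'|]// [? ?] _; subst a' b'.
  by congr (_, _); [apply: i1|apply: i2]; rewrite ?E1 ?E2.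
exists (h _ _ _ _ f1 f2), (h _ _ _ _ g1 g2); split; try exact: hi.
move=> [x1 x2] [y1 y2]; rewrite /tens /h/= H1 H2.
case: (f1 x1) => [a|]; last by rewrite mul0r.
case: (f2 x2) => [b|]; last by rewrite mulr0; case: (g1 y1).
case: (g1 y1) => [a'|]; last by rewrite mul0r.
by case: (g2 y2) => [b'|]; rewrite ?mulr0.
Qed.

Lemma emb_refl {I J : finType} (K : I -> J -> F) : emb K K.
Proof. by apply: (emb_inj id id). Qed.

(** Deleting or relabelling lines and bordering by zeros raise neither sparsity nor rank; the size
    condition keeps the rank fraction valid for [K]. *)
Lemma slr_emb {I J I' J' : finType} {K : I -> J -> F} {K' : I' -> J' -> F} {r s : R} :
  emb K K' -> (#|I'| <= #|I|)%N -> 0 <= r -> slr K' r s -> slr K r s.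
Proof.
move=> [f [g [fi gi H]]] cI r0 [A [n [T [u [v [HK [Hr Hc] Hn HT]]]]]].
exists (fun x y => match f x, g y with Some a, Some b => A a b | _, _ => 0 end), n, T,
  (fun x t => if f x is Some a then u a t else 0),
  (fun t y => if g y is Some b then v t b else 0).
have small (P Q : finType) (h : P -> option Q) (B : {set Q}) (C : {set P}) :
    pinj h -> (forall p, p \in C -> exists2 q, h p = Some q & q \in B) -> (#|C| <= #|B|)%N.
  move=> hi hC; rewrite -(card_in_imset (f := h)); last first.
    by move=> p p' /hC[q E _] _ E'; apply: hi => //; rewrite E.
  have Si : injective (@Some Q) by move=> ? ? [].
  rewrite -(card_imset _ Si); apply/subset_leq_card/subsetP=> o /imsetP[p /hC[q E qB] ->].
  by rewrite E; apply: imset_f.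
split=> //.
- move=> x y; rewrite H.
  case: (f x) => [a|]; last by rewrite add0r big1// => t _; rewrite mul0r.
  case: (g y) => [b|]; last by rewrite add0r big1// => t _; rewrite mulr0.
  exact: HK.
- split=> [x|y].
    case E: (f x) => [a|]; last first.
      by rewrite (_ : [set _ | _] = set0) ?cards0//; apply/setP=> i; rewrite !inE eqxx.
    apply: leq_trans (Hr a); apply: (small _ _ g) => // y; rewrite !inE.
    by case: (g y) => [b|]; rewrite ?eqxx// => ?; exists b; rewrite ?inE.
  case E: (g y) => [b|]; last first.
    rewrite (_ : [set _ | _] = set0) ?cards0//; apply/setP=> i; rewrite !inE.
    by case: (f i); rewrite eqxx.
  apply: leq_trans (Hc b); apply: (small _ _ f) => // x; rewrite !inE.
  by case: (f x) => [a|]; rewrite ?eqxx// => ?; exists a; rewrite ?inE.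
- by apply: (le_trans HT); rewrite ler_wpM2l// ler_nat.
Qed.

(** * Tensor products over a list of orders *)

Fixpoint tidx (ds : seq nat) : finType :=
  if ds is d :: ds' then ('I_d * tidx ds')%type else unit.

Variable kappa : forall d, 'I_d -> 'I_d -> F.

Fixpoint tker (ds : seq nat) : tidx ds -> tidx ds -> F :=
  if ds is d :: ds' then tens (@kappa d) (@tker ds') else fun _ _ => 1.
End SparseLowRank.

Arguments slr_trivial {R F I} K.
Arguments tker {F} kappa ds.
Arguments emb {F I J I' J'} K K'.
Arguments emb_inj {F I J I' J' K K'} f g.
Arguments tens {F I1 J1 I2 J2} K1 K2 x y.

Lemma card_tidx ds : #|tidx ds| = (\prod_(d <- ds) d)%N.
Proof.
by elim: ds => [|d ds IH]; rewrite ?card_unit ?big_nil// big_cons/= card_prod card_ord IH.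
Qed.

Section TensorLists.
Variables (R : realFieldType) (F : fieldType).
Variable kappa : forall d, 'I_d -> 'I_d -> F.

Lemma emb_cat ds1 ds2 :
  emb (tker kappa (ds1 ++ ds2)) (tens (tker kappa ds1) (tker kappa ds2)).
Proof.
elim: ds1 => [|d ds IH] /=.
  apply: (emb_inj (fun x => (tt, x)) (fun x => (tt, x))); try by move=> ? ? [].
  by move=> x y; rewrite /tens/= mul1r.
apply: emb_trans (emb_tens (emb_refl _) IH) _.
apply: (emb_inj (fun x => ((x.1, x.2.1), x.2.2)) (fun x => ((x.1, x.2.1), x.2.2))).
- by move=> [? [? ?]] [? [? ?]] [-> -> ->].
- by move=> [? [? ?]] [? [? ?]] [-> -> ->].
- by move=> [? [? ?]] [? [? ?]]; rewrite /tens/= mulrA.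
Qed.

Lemma emb_cat_rev ds1 ds2 :
  emb (tens (tker kappa ds1) (tker kappa ds2)) (tker kappa (ds1 ++ ds2)).
Proof.
elim: ds1 => [|d ds IH] /=.
  apply: (emb_inj snd snd) => [[[] ?] [[] ?] /= ->|[[] ?] [[] ?] /= ->|x y] //.
  by rewrite /tens/= mul1r.
apply: (emb_trans _ (emb_tens (emb_refl _) IH)).
apply: (emb_inj (fun x => (x.1.1, (x.1.2, x.2))) (fun x => (x.1.1, (x.1.2, x.2)))).
- by move=> [[? ?] ?] [[? ?] ?] [-> -> ->].
- by move=> [[? ?] ?] [[? ?] ?] [-> -> ->].
- by move=> [[? ?] ?] [[? ?] ?]; rewrite /tens/= mulrA.
Qed.

Lemma emb_swap (I1 J1 I2 J2 I3 J3 : finType) (K1 : I1 -> J1 -> F) (K2 : I2 -> J2 -> F)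
  (K3 : I3 -> J3 -> F) : emb (tens K1 (tens K2 K3)) (tens K2 (tens K1 K3)).
Proof.
apply: (emb_inj (fun x => (x.2.1, (x.1, x.2.2))) (fun x => (x.2.1, (x.1, x.2.2)))).
- by move=> [? [? ?]] [? [? ?]] [-> -> ->].
- by move=> [? [? ?]] [? [? ?]] [-> -> ->].
- by move=> [? [? ?]] [? [? ?]]; rewrite /tens/= mulrCA.
Qed.

Lemma emb_perm ds1 ds2 : perm_eq ds1 ds2 -> emb (tker kappa ds1) (tker kappa ds2).
Proof.
have ins d s1 s2 : emb (tker kappa (d :: s1 ++ s2)) (tker kappa (s1 ++ d :: s2)).
  elim: s1 => [|e s1 IH]; first exact: emb_refl.
  exact: emb_trans (emb_swap _ _ _) (emb_tens (emb_refl _) IH).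
elim: ds1 ds2 => [|d ds IH] ds2 P.
  by case: ds2 P => [_|e ds2 /perm_size//]; apply: emb_refl.
have dP : d \in ds2 by rewrite -(perm_mem P) mem_head.
case/splitPr: dP P => s1 s2 P; apply: (emb_trans _ (ins d s1 s2)) => /=.
have /IH h : perm_eq ds (s1 ++ s2); last exact: emb_tens (emb_refl _) h.
rewrite -(perm_cons d) (permPl P) -[d :: s2]cat1s -[d :: (s1 ++ s2)]cat1s.
by rewrite perm_catCA.
Qed.

Lemma slr_cat {ds1 ds2 : seq nat} {r1 s1 r2 s2 : R} : 0 <= r1 -> 0 <= r2 ->
  slr (tker kappa ds1) r1 s1 -> slr (tker kappa ds2) r2 s2 ->
  slr (tker kappa (ds1 ++ ds2)) (r1 + r2) (s1 * s2).
Proof.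
move=> p1 p2 h1 h2; apply: (slr_emb (emb_cat _ _)); last exact: slr_tens.
  by rewrite card_prod !card_tidx big_cat.
exact: addr_ge0.
Qed.

Lemma slr_perm {ds1 ds2 : seq nat} {r s : R} : 0 <= r -> perm_eq ds1 ds2 ->
  slr (tker kappa ds2) r s -> slr (tker kappa ds1) r s.
Proof.
move=> r0 P; apply: slr_emb => //; first exact: emb_perm.
by rewrite !card_tidx (perm_big _ P).
Qed.

(** By induction on [D], the entries equal to the largest value are split off as one block. Each of
    the at most [D] blocks costs [r] in rank fraction and one factor [a]; the factors [b] count
    entries. *)
Lemma slr_group (D : nat) (ds : seq nat) (r a b : R) : 0 <= r -> 1 <= a ->
  (forall d n, (2 <= d <= D)%N -> (n <= size ds)%N ->
     slr (tker kappa (nseq n d)) r (a * b ^+ n)) ->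
  all (fun d => 2 <= d <= D)%N ds ->
  slr (tker kappa ds) (D%:R * r) (a ^+ D * b ^+ size ds).
Proof.
move=> r0 a1; elim: D ds => [|D IH] ds H.
  case: ds H => [|d ds] _ /=; last by case: d => [|[]].
  move=> _; rewrite mul0r !expr0 mulr1.
  by have := slr_trivial (R := R) (tker kappa [::]); rewrite card_unit.
move=> Hall; have [D0|D0] := posnP D.
  case: ds H Hall => [|d ds] H; last first.
    by rewrite D0 /= => /andP[]; case: d H => [|[|d]].
  move=> _; rewrite D0 mul1r expr1 expr0 mulr1.
  by have := slr_trivial (R := R) (tker kappa [::]); rewrite card_unit; apply: slr_weaken.
pose A := [seq d <- ds | d == D.+1]; pose B := [seq d <- ds | d != D.+1].
have P : perm_eq ds (A ++ B) by rewrite perm_sym; apply/permPl/perm_filterC.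
have AE : A = nseq (size A) D.+1 by apply/all_pred1P; apply: filter_all.
have szE : size ds = (size A + size B)%N by rewrite -size_cat; apply: perm_size.
apply: (slr_perm _ P); first by rewrite mulr_ge0.
have hB : slr (tker kappa B) (D%:R * r) (a ^+ D * b ^+ size B).
  apply: IH.
    move=> d n /andP[d2 dD] nB; apply: H; first by rewrite d2 (leq_trans dD).
    by rewrite szE (leq_trans nB) ?leq_addl.
  apply/allP=> d; rewrite mem_filter => /andP[dD /(allP Hall)/andP[-> /=]].
  by rewrite leq_eqVlt (negPf dD).
have hA : slr (tker kappa A) r (a * b ^+ size A).
  suff : slr (tker kappa (nseq (size A) D.+1)) r (a * b ^+ size A) by rewrite -AE.
  by apply: H; rewrite ?leqnn ?ltnS ?D0// szE leq_addr.
have := slr_cat r0 _ hA hB; rewrite mulr_ge0// => /(_ isT).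
by apply: slr_weaken; rewrite ?szE ?exprS ?exprD -?natr1 ?mulrDl ?mul1r ?[r + _]addrC// mulrACA.
Qed.

End TensorLists.

(** * Roots of unity and relabellings of Fourier matrices *)

Section RootsOfUnity.
Variables (F : fieldType) (w : nat -> F).
Hypothesis wP : forall d, (0 < d)%N -> d.-primitive_root (w d).

Definition fourier d (x y : 'I_d) : F := w d ^+ (x * y)%N.

Lemma natf_neq0_roots n : (0 < n)%N -> n%:R != 0 :> F.
Proof. by move=> /wP; apply: prim_root_natf_neq0. Qed.

Lemma emb_fourier_mul a b : (0 < a)%N -> (0 < b)%N -> coprime a b ->
  emb (@fourier (a * b)) (tens (@fourier a) (@fourier b)).
Proof.
move=> a0 b0 cab; have ab0 : (0 < a * b)%N by rewrite muln_gt0 a0.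
have zP := wP ab0; set z := w (a * b) in zP.
(* The family [w] is arbitrary, so [w (a * b)] need not be compatible with [w a] and [w b]; the
   exponents [u] and [v] record the discrepancy. *)
have [u zu] : exists u, z ^+ chinese a b 1 0 = w a ^+ u.
  have [|u ->] := prim_rootP (wP a0) (x := z ^+ chinese a b 1 0); last by exists u.
  apply/eqP; rewrite -exprM -(prim_order_dvd zP) mulnC.
  rewrite dvdn_mul// /dvdn; apply/eqP; rewrite (chinese_modr cab) mod0n//.
have [v zv] : exists v, z ^+ chinese a b 0 1 = w b ^+ v.
  have [|v ->] := prim_rootP (wP b0) (x := z ^+ chinese a b 0 1); last by exists v.
  apply/eqP; rewrite -exprM -(prim_order_dvd zP).
  rewrite dvdn_mul// /dvdn; apply/eqP; rewrite (chinese_modl cab) mod0n//.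
have zE : z = w a ^+ u * w b ^+ v.
  rewrite -zu -zv -exprD -[LHS]expr1; apply/eqP; rewrite (eq_prim_root_expr zP).
  rewrite chinese_remainder//; apply/andP; split; apply/eqP.
    by rewrite -modnDm (chinese_modl cab) (chinese_modl cab 0) modnDm.
  by rewrite -modnDm (chinese_modr cab) (chinese_modr cab 0) modnDm.
have key (t t' : 'I_(a * b)) : z ^+ t = z ^+ t' -> t = t'.
  move=> /eqP; rewrite (eq_prim_root_expr zP) !modn_small// => /eqP; exact: val_inj.
pose ma (t : nat) : 'I_a := Ordinal (ltn_pmod t a0).
pose mb (t : nat) : 'I_b := Ordinal (ltn_pmod t b0).
(* Rows are reduced modulo a and b, and the columns absorb [u] and [v]. Either pair of residues
   determines the power of [z], hence the index. *)
apply: (emb_inj (fun x : 'I_(a * b) => (ma x, mb x))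
  (fun y : 'I_(a * b) => (ma (u * y)%N, mb (v * y)%N))).
- move=> x x' [ex ex']; apply: key; rewrite zE !exprMn -!exprM.
  rewrite -[LHS](congr2 _ (prim_expr_mod (wP a0) _) (prim_expr_mod (wP b0) _)).
  rewrite -[RHS](congr2 _ (prim_expr_mod (wP a0) _) (prim_expr_mod (wP b0) _)).
  by rewrite -(modnMmr u x) ex modnMmr -(modnMmr v x) ex' modnMmr.
- move=> x x' [ex ex']; apply: key; rewrite zE !exprMn -!exprM.
  rewrite -[LHS](congr2 _ (prim_expr_mod (wP a0) _) (prim_expr_mod (wP b0) _)).
  rewrite -[RHS](congr2 _ (prim_expr_mod (wP a0) _) (prim_expr_mod (wP b0) _)).
  by rewrite ex ex'.
- move=> x y; rewrite /tens /fourier /= -/z zE exprMn -!exprM.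
  congr (_ * _).
    by rewrite -[LHS](prim_expr_mod (wP a0)) -[RHS](prim_expr_mod (wP a0)) modnMm mulnCA.
  by rewrite -[LHS](prim_expr_mod (wP b0)) -[RHS](prim_expr_mod (wP b0)) modnMm mulnCA.
Qed.

Lemma emb_fourier_prod ds N : pairwise coprime ds -> all (leq 1) ds ->
  N = (\prod_(d <- ds) d)%N -> emb (@fourier N) (tker fourier ds).
Proof.
elim: ds N => [|d ds IH] N /=.
  rewrite big_nil => _ _ ->; apply: (emb_inj (fun=> tt) (fun=> tt)).
  - by move=> x y _; rewrite (ord1 x) (ord1 y).
  - by move=> x y _; rewrite (ord1 x) (ord1 y).
  - by move=> x y; rewrite /fourier (ord1 x) mul0n expr0.
rewrite big_cons => /andP[cd cds] /andP[d0 ds0] ->.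
apply: (emb_trans _ (emb_tens (emb_refl _) (IH _ cds ds0 erefl))).
apply: emb_fourier_mul => //.
  by elim: (ds) ds0 => [|e es IHe]; rewrite ?big_nil// big_cons /= muln_gt0 => /andP[-> /IHe].
elim: (ds) cd => [|e es IHe]; first by rewrite big_nil coprimen1.
by rewrite big_cons /= coprimeMr => /andP[-> /IHe].
Qed.

Lemma sum_root_eq0 d v : (0 < d)%N -> ~~ (d %| v)%N -> \sum_(k < d) w d ^+ (k * v) = 0.
Proof.
move=> d0 nv; have H := wP d0.
have : (w d ^+ v - 1) * \sum_(k < d) w d ^+ (k * v) = 0.
  under eq_bigr do rewrite mulnC exprM.
  by rewrite -subrX1 -exprM mulnC exprM (prim_expr_order H) expr1n subrr.
move/eqP; rewrite mulf_eq0 => /orP[|/eqP//].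
by rewrite subr_eq0 -(prim_order_dvd H) (negPf nv).
Qed.

Lemma fourier_inversion d (g : nat -> F) : (0 < d)%N -> (forall t, g (t %% d)%N = g t) ->
  exists h : 'I_d -> F, forall t, g t = \sum_(k < d) h k * w d ^+ (k * t).
Proof.
move=> d0 gp; have H := wP d0.
(* The exponent [d - u] stands for -u modulo d. *)
exists (fun k => d%:R^-1 * \sum_(u < d) g u * w d ^+ (k * (d - u))) => t.
rewrite -gp; have td := ltn_pmod t d0; set t' := Ordinal td.
transitivity (d%:R^-1 * \sum_(u < d) g u * \sum_(k < d) w d ^+ (k * ((d - u) + t))).
  rewrite (bigD1 t')//= [X in _ + X]big1 ?addr0.
    rewrite [X in _ * (_ * X)](_ : _ = d%:R).
      by rewrite mulrCA mulVf ?mulr1// natf_neq0_roots.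
    rewrite -[in RHS](card_ord d) -sumr_const; apply: eq_bigr => k _.
    apply/eqP; rewrite -(prim_order_dvd H) dvdn_mull//.
    rewrite (_ : (d - t' + t)%N = (d + t %/ d * d)%N) ?dvdn_add ?dvdn_mull//.
    have -> : nat_of_ord t' = (t %% d)%N by [].
    by move: (divn_eq t d) (ltn_pmod t d0); lia.
  move=> u nu; rewrite sum_root_eq0 ?mulr0//; apply: contra nu => du.
  apply/eqP/val_inj => /=; have ud := ltn_ord u.
  have : (d - u + t = d - u + u %[mod d])%N.
    by rewrite subnK ?(ltnW ud)// modnn; apply/eqP.
  by move/eqP; rewrite eqn_modDl (modn_small ud) => /eqP.
rewrite mulr_sumr.
under eq_bigr do rewrite mulr_sumr mulr_sumr.
rewrite exchange_big; apply: eq_bigr => k _ /=.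
rewrite mulr_sumr mulr_suml; apply: eq_bigr => u _.
by rewrite mulnDr exprD; ring.
Qed.

(** A square root of [w d] gives meaning to the exponent xy = ((x + y)^2 - x^2 - y^2) / 2; the
    second property makes zeta^(t^2) a function on Z/d. *)
Lemma quadratic_root d : (0 < d)%N ->
  exists2 zeta : F, zeta ^+ 2 = w d & forall t, zeta ^+ ((t %% d) ^ 2) = zeta ^+ (t ^ 2).
Proof.
move=> d0; have H := wP d0.
suff [z z2 zd] : exists2 z, z ^+ 2 = w d & z ^+ (d ^ 2) = 1.
  exists z => // t.
  have -> : (t ^ 2 = (t %% d) ^ 2 + d ^ 2 * (t %/ d) ^ 2 + 2 * (d * (t %/ d * (t %% d))))%N.
    by rewrite {1}(divn_eq t d); ring.
  rewrite exprD (exprM z 2) z2 (exprM (w d) d) exprD (exprM z (d ^ 2)) zd.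
  by rewrite (prim_expr_order H) !expr1n !mulr1.
(* For odd d, (d + 1)/2 is half of 1 modulo d. For even d, d^2 is a multiple of 2d, so every 2d-th
   root of unity has d^2-th power 1. *)
have [od|ed] := boolP (odd d).
  exists (w d ^+ (d.+1./2)); last by rewrite -exprM -mulnn mulnCA exprM (prim_expr_order H) expr1n.
  rewrite -exprM muln2 -[RHS](expr1) (_ : d.+1./2.*2 = d.+1)%N.
    by rewrite exprS (prim_expr_order H) mulr1 expr1.
  by rewrite -[RHS]odd_double_half /= od.
have H2 : (2 * d).-primitive_root (w (2 * d)) by apply: wP; rewrite muln_gt0.
have H2' : d.-primitive_root (w (2 * d) ^+ 2).
  by have := dvdn_prim_root H2 (dvdn_mull 2 (dvdnn d)); rewrite mulnK.
have [k ->] := prim_rootP H2' (prim_expr_order H).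
exists (w (2 * d) ^+ k); first by rewrite exprAC.
have -> : (d ^ 2 = 2 * d * d./2)%N.
  by rewrite -mulnn -{2}(odd_double_half d) (negPf ed) add0n -mul2n mulnCA mulnA.
by rewrite exprAC exprM (prim_expr_order H2) !expr1n.
Qed.

(** Here [e] is the discrete logarithm to a generator z of the units of F_q, with an arbitrary value
    at 0, and [f t] is [w q] to the power z^t. *)
Lemma dlog q : prime q ->
  exists (e : 'I_q -> 'I_q.-1) (f : nat -> F),
  [/\ forall t, f (t %% q.-1)%N = f t,
      forall x y : 'I_q, x != 0%N :> nat -> y != 0%N :> nat -> e x = e y -> x = y &
      forall x y : 'I_q, x != 0%N :> nat -> y != 0%N :> nat ->
        w q ^+ (x * y) = f (e x + e y)%N].
Proof.
move=> pq; have q1 : (0 < q.-1)%N by rewrite -subn1 subn_gt0 prime_gt1.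
have q0 := prime_gt0 pq.
have fermat (x : 'F_q) : x != 0 -> x ^+ q.-1 = 1.
  move=> x0; apply: (mulfI x0); rewrite mulr1 -exprS prednK//.
  by have := expf_card x; rewrite card_Fp.
have : has q.-1.-primitive_root [seq x <- enum 'F_q | x != 0].
  have sz : size [seq x <- enum 'F_q | x != 0] = q.-1.
    have := cardC1 (0 : 'F_q); rewrite card_Fp// => <-; rewrite cardE.
    by rewrite enumT /enum_mem; congr size; apply: eq_filter => x.
  apply: has_prim_root => //; last by rewrite sz.
  - apply/allP=> x; rewrite mem_filter unity_rootE => /andP[x0 _].
    by rewrite fermat.
  - by rewrite filter_uniq ?enum_uniq.
case/hasP => z _ zP.
have nz (x : 'I_q) : x != 0%N :> nat -> (x%:R : 'F_q) != 0.
  by apply: contra => /eqP/(congr1 val); rewrite /= val_Fp_nat// modn_small// => ->.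
have ex (x : 'I_q) : exists i : 'I_q.-1, x != 0%N :> nat -> (x%:R : 'F_q) = z ^+ i.
  have [->|x0] := eqVneq (x : nat) 0%N; first by exists (Ordinal q1).
  have [|i ->] := prim_rootP zP (x := x%:R); last by exists i.
  by rewrite fermat ?nz.
have [e he] := fin_all_exists ex.
exists e, (fun t => w q ^+ val (z ^+ t)); split.
- by move=> t; rewrite (prim_expr_mod zP).
- move=> x y x0 y0 E; apply: val_inj => /=.
  have /(congr1 val) := he x x0; rewrite E -he//= !val_Fp_nat// !modn_small//.
- move=> x y x0 y0; rewrite exprD -!he// -natrM /= val_Fp_nat//.
  by rewrite (prim_expr_mod (wP q0)).
Qed.
End RootsOfUnity.

(** * Tensor powers of one Fourier matrix *)

Section Hadamard.
Variables (F : fieldType) (w : nat -> F).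
Hypothesis wP : forall d, (0 < d)%N -> d.-primitive_root (w d).
Variables (d' n : nat).
Let d := d'.+1.
Let V : finType := {ffun 'I_n -> 'I_d'.+1}.
Implicit Types (x y k v : {ffun 'I_n -> 'I_d'.+1}) (j : 'I_d'.+1).

Definition cnt j k : nat := #|[set i | k i == j]|.

Definition wt v : nat := #|[set i | v i != ord0]|.

(** The entries of the n-th tensor power of [fourier], that is, the characters of (Z/d)^n. *)
Definition chi k v : F := \prod_i w d ^+ (k i * v i)%N.

Lemma chiC k v : chi k v = chi v k.
Proof. by apply: eq_bigr => i _; rewrite mulnC. Qed.

Lemma chiD x y v : chi (x + y) v = chi x v * chi y v.
Proof.
rewrite /chi -big_split; apply: eq_bigr => i _ /=; rewrite !ffunE /=.
have H := wP (ltn0Sn d').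
by rewrite -(prim_expr_mod H) modnMml mulnDl (prim_expr_mod H) exprD.
Qed.

Lemma natf_neq (a b : nat) : a != b -> a%:R - b%:R != 0 :> F.
Proof.
wlog lt_ab : a b / (b < a)%N.
  move=> H; case: (ltngtP a b) => // lab _; last by apply: H => //; rewrite gtn_eqF.
  by rewrite -opprB oppr_eq0; apply: H => //; rewrite gtn_eqF.
by move=> _; rewrite -natrB ?(ltnW lt_ab)// (natf_neq0_roots wP)// subn_gt0.
Qed.

(* The Fourier transform of a function of at most #|T| coordinates is supported on
   vectors of weight at most #|T|; expand the product. *)
Lemma fourier_junta_eq0 (T : finType) (e : T -> 'I_d'.+1 -> F) v : (#|T| < wt v)%N ->
  \sum_(k : V) (\prod_t \sum_i e t (k i)) * chi k v = 0.
Proof.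
move=> lt_wt.
under eq_bigr do rewrite bigA_distr_bigA /= mulr_suml.
rewrite exchange_big big1// => tau _.
(* Some coordinate with nonzero letter in [v] is not read by [tau]. Shifting k there fixes the
   product and multiplies the character by a root of unity other than 1, so the sum vanishes. *)
have [i vi ni] : exists2 i, v i != ord0 & forall t, tau t != i.
  have [i /andP[vi ni]|no] :=
      pickP [pred i | (v i != ord0) && (i \notin [set tau t | t in T])].
    by exists i => // t; apply: contra ni => /eqP <-; apply: imset_f.
  move: lt_wt; rewrite ltnNge => /negP[]; apply: (@leq_trans #|[set tau t | t in T]|).
    apply/subset_leq_card/subsetP => i; rewrite inE => vi.
    by move: (no i); rewrite /= vi /= => /negbFE.
  by apply: leq_trans (leq_imset_card _ _) _; rewrite cardT.
set S := \sum_k _.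
pose delta : {ffun 'I_n -> 'I_d'.+1} := [ffun i' => if i' == i then inZp 1 else 0].
have H := wP (ltn0Sn d').
have chid : chi delta v = w d ^+ v i.
  rewrite /chi (bigD1 i)//= ffunE eqxx big1 ?mulr1.
    by rewrite -(prim_expr_mod H) modnMml mul1n (prim_expr_mod H).
  by move=> i' /negPf ni'; rewrite ffunE ni' mul0n expr0.
have : (w d ^+ v i - 1) * S = 0.
  rewrite mulrBl mul1r {1}/S -chid mulr_sumr; apply/eqP; rewrite subr_eq0; apply/eqP.
  rewrite /S [RHS](reindex_inj (addrI delta)); apply: eq_bigr => k _.
  rewrite chiD mulrCA; congr (_ * (_ * _)); apply: eq_bigr => t _.
  by rewrite !ffunE (negPf (ni t)) add0r.
move/eqP; rewrite mulf_eq0 => /orP[|/eqP//].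
rewrite subr_eq0 -(prim_order_dvd H) => /dvdn_leq; rewrite lt0n => /(_ vi).
by rewrite leqNgt ltn_ord.
Qed.

Definition balanced (a m : nat) : {set V} :=
  [set k : V | [forall j, (a <= cnt j k < a + m)%N]].

(** On balanced k the product of the [h (k i)] depends only on the d letter counts, each among m
    values. Lagrange interpolation at each node uses d m factors affine in a count, hence sums over
    coordinates, as [fourier_junta_eq0] requires. *)
Lemma interpolation (h : 'I_d'.+1 -> F) a m : (0 < n)%N ->
  exists P : V -> F, (forall k, k \in balanced a m -> P k = \prod_i h (k i)) /\
    forall v, (d * m < wt v)%N -> \sum_(k : V) P k * chi k v = 0.
Proof.
move=> n0; have nn : n%:R != 0 :> F := natf_neq0_roots wP n0.
(* The node is [c], and [t] is a pair (letter, value). Constants are spread evenly over the n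
   coordinates; the factor omitted by the Lagrange formula becomes 1, as n times 1/n. *)
pose e (c : {ffun 'I_d'.+1 -> 'I_m}) (t : 'I_d'.+1 * 'I_m) (u : 'I_d'.+1) : F :=
  if t.2 == c t.1 then n%:R^-1
  else ((u == t.1)%:R - (a + t.2)%:R / n%:R) / ((c t.1)%:R - t.2%:R).
have eE c t k : \sum_i e c t (k i) = if t.2 == c t.1 then 1
    else ((cnt t.1 k)%:R - (a + t.2)%:R) / ((c t.1)%:R - t.2%:R).
  rewrite /e; case: ifP => _; first by rewrite sumr_const card_ord -[LHS]mulr_natr mulVf.
  rewrite -mulr_suml sumrB sumr_const card_ord -[X in _ - X]mulr_natr divfK//.
  congr ((_ - _) / _); rewrite /cnt -sum1_card natr_sum [RHS]big_mkcond/=.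
  by apply: eq_bigr => i _; rewrite inE; case: (_ == _).
pose Phi (c : {ffun 'I_d'.+1 -> 'I_m}) := \prod_j h j ^+ (a + c j).
exists (fun k => \sum_c Phi c * \prod_t \sum_i e c t (k i)); split; last first.
  move=> v lt_wt; under eq_bigr do rewrite mulr_suml.
  rewrite exchange_big big1//= => c _; under eq_bigr do rewrite -mulrA.
  by rewrite -mulr_sumr fourier_junta_eq0 ?mulr0// card_prod !card_ord.
move=> k; rewrite inE => /forallP kZ.
have lt_m j : (cnt j k - a < m)%N by have /andP[] := kZ j; lia.
pose c0 : {ffun 'I_d'.+1 -> 'I_m} := [ffun j => Ordinal (lt_m j)].
have c0E j : (a + c0 j = cnt j k)%N by rewrite ffunE /=; have /andP[] := kZ j; lia.
rewrite (bigD1 c0)//= [X in _ + X]big1 ?addr0; last first.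
  move=> c; rewrite eq_sym => ne; have [j nej] : exists j, c0 j != c j.
    apply/existsP; rewrite -negb_forall; apply: contra ne => /forallP E.
    by apply/eqP/ffunP => j; apply/eqP.
  rewrite (bigD1 (j, c0 j))//= eE /= (negPf nej) c0E subrr !mul0r mulr0//.
rewrite [X in _ * X]big1 ?mulr1; last first.
  move=> [j b] _; rewrite eE /=; case: ifPn => // ne.
  rewrite -c0E (_ : _ - _ = (c0 j)%:R - b%:R); last by rewrite !natrD; ring.
  by rewrite mulfV// natf_neq// eq_sym.
rewrite /Phi (partition_big (fun i => k i) xpredT)//=; apply: eq_bigr => j _.
rewrite c0E /cnt -prodr_const; under [RHS]eq_bigr => i /eqP -> do over.
by apply: eq_bigl => i; rewrite inE.
Qed.

(* The product x_i y_i is ((x_i + y_i)^2 - x_i^2 - y_i^2) / 2, so up to diagonal scaling the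
   matrix is f(x + y) with f a product function. The Fourier transform of f depends only
   on letter counts; correct f on vectors of small weight so that it vanishes on
   balanced letter counts. *)
Lemma slr_hadamard (R : realFieldType) a m : (0 < n)%N ->
  slr (fun x y : V => chi x y) (#|~: balanced a m|%:R / #|V|%:R : R)
    #|[set v : V | (wt v <= d * m)%N]|%:R.
Proof.
move=> n0; have H := wP (ltn0Sn d').
have [zeta z2 zp] := quadratic_root wP (ltn0Sn d').
have zeta0 : zeta != 0.
  by apply/eqP => z0; move: z2; rewrite z0 expr0n => /esym/eqP; rewrite (prim_root_eq0 H).
have [h hE] := fourier_inversion wP (ltn0Sn d') zp.
have [P [PZ Psupp]] := interpolation h a m n0.
pose f1 v := \sum_(k : V) P k * chi k v.
pose D x := \prod_i (zeta ^+ (x i ^ 2)%N)^-1.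
(* By [hE] in each coordinate, the inner sum is the product of the zeta^((x_i + y_i)^2). *)
apply: (@slr_ext _ _ _ _ (fun x y : V =>
  D x * (\sum_(k : V) (\prod_i h (k i)) * chi k (x + y)) * D y)).
  move=> x y; rewrite /D /chi.
  have -> : \sum_(k : V) (\prod_i h (k i)) * (\prod_i w d ^+ (k i * (x + y)%R i)) =
      \prod_i \sum_u h u * w d ^+ (u * (x + y)%R i).
    by rewrite bigA_distr_bigA /=; apply: eq_bigr => k _; rewrite big_split.
  rewrite -!big_split /=.
  apply: eq_bigr => i _; rewrite -hE !ffunE /= zp sqrnD exprD exprD.
  rewrite [zeta ^+ (2 * _)]exprM z2; field.
  by rewrite !expf_neq0.
apply: slr_scale.
pose ev (t : 'I_#|~: balanced a m|) : {ffun 'I_n -> 'I_d'.+1} := enum_val t.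
(* The product function and [f1] have the same Fourier coefficients on balanced k, so their
   difference is a sum of one rank-one term per unbalanced k. *)
exists (fun x y => f1 (x + y)), #|[set v : V | (wt v <= d * m)%N]|, 'I_#|~: balanced a m|,
  (fun x t => (\prod_i h (ev t i) - P (ev t)) * chi (ev t) x),
  (fun t y => chi (ev t) y); split=> //.
- move=> x y; rewrite /f1.
  rewrite -(big_enum_val (fun k : V => (\prod_i h (k i) - P k) * chi k x * chi k y)) /=.
  have -> : \sum_(k in ~: balanced a m) (\prod_i h (k i) - P k) * chi k x * chi k y =
      \sum_(k : V) (\prod_i h (k i) - P k) * chi k (x + y); last first.
    by rewrite -big_split; apply: eq_bigr => k _ /=; ring.
  rewrite big_mkcond; apply: eq_bigr => k _ /=; rewrite inE.
  have [/PZ ->|_] /= := boolP (k \in balanced a m); first by rewrite subrr mul0r.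
  by rewrite ![chi k _]chiC chiD mulrA.
- split=> z.
    rewrite -(card_imset _ (addrI z)); apply/subset_leq_card/subsetP => _ /imsetP[y + ->].
    by rewrite !inE; apply: contraR; rewrite -ltnNge => /Psupp/eqP.
  rewrite -(card_imset _ (addIr z)); apply/subset_leq_card/subsetP => _ /imsetP[y + ->].
  by rewrite !inE; apply: contraR; rewrite -ltnNge => /Psupp/eqP.
- by rewrite card_ord mulfVK// pnatr_eq0 -lt0n card_ffun !card_ord expn_gt0.
Qed.

(** * Exponential moments of letter counts *)

Section Counting.
Variable R : realFieldType.

Lemma sum_cnt (lam : R) j : \sum_(k : V) lam ^+ cnt j k = (lam + d'%:R) ^+ n.
Proof.
have -> : (lam + d'%:R) ^+ n = \prod_(i < n) \sum_(u < d'.+1) (if u == j then lam else 1).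
  rewrite prodr_const card_ord; congr (_ ^+ _).
  rewrite (bigD1 j)//= eqxx; congr (_ + _).
  under eq_bigr => u /negPf -> do over.
  by rewrite sumr_const cardC1 card_ord.
rewrite bigA_distr_bigA /=; apply: eq_bigr => k _.
by rewrite -big_mkcond /= prodr_const /cnt cardsE.
Qed.

Lemma card_cnt_ge (lam : R) j b : 1 <= lam ->
  #|[set k : V | (b <= cnt j k)%N]|%:R * lam ^+ b <= (lam + d'%:R) ^+ n.
Proof.
move=> lam1; have lam0 : 0 <= lam by apply: le_trans lam1.
rewrite -(sum_cnt lam j) [leRHS](bigID (fun k => b <= cnt j k)%N) /=.
rewrite -[leLHS]addr0 lerD ?sumr_ge0// => [|k _]; last exact: exprn_ge0.
rewrite mulrC -sumr_const mulr_sumr.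
rewrite big_mkcond [leRHS]big_mkcond; apply: ler_sum => k _; rewrite inE.
by case: ifP => // bk; rewrite mulr1 ler_weXn2l.
Qed.

Lemma card_cnt_le (lam : R) j b : 0 <= lam <= 1 ->
  #|[set k : V | (cnt j k <= b)%N]|%:R * lam ^+ b <= (lam + d'%:R) ^+ n.
Proof.
move=> /andP[lam0 lam1].
rewrite -(sum_cnt lam j) [leRHS](bigID (fun k => cnt j k <= b)%N) /=.
rewrite -[leLHS]addr0 lerD ?sumr_ge0// => [|k _]; last exact: exprn_ge0.
rewrite mulrC -sumr_const mulr_sumr.
rewrite big_mkcond [leRHS]big_mkcond; apply: ler_sum => k _; rewrite inE.
by case: ifP => // bk; rewrite mulr1 ler_wiXn2l.
Qed.

Lemma card_wt_le (lam : R) b : 1 <= lam ->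
  #|[set v : V | (wt v <= b)%N]|%:R <= lam ^+ b * (1 + d'%:R / lam) ^+ n.
Proof.
move=> lam1; have lam0 : 0 < lam by apply: lt_le_trans lam1.
have wtE (v : V) : (wt v = n - cnt ord0 v)%N.
  have := cardsC [set i | v i == ord0]; rewrite card_ord /cnt /wt.
  have -> : ~: [set i | v i == ord0] = [set i | v i != ord0] by apply/setP => i; rewrite !inE.
  by move=> E; apply/esym; rewrite -[X in (X - _)%N]E addKn.
have cntn (v : V) : (cnt ord0 v <= n)%N by apply: leq_trans (max_card _) _; rewrite card_ord.
have -> : 1 + d'%:R / lam = (lam + d'%:R) / lam by field; rewrite gt_eqF.
rewrite expr_div_n mulrA ler_pdivlMr ?exprn_gt0//.
(* Weight at most b means at least n - b zeros. For b > n the difference is truncated to 0, and n <=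
   b + (n - b) still holds. *)
apply: le_trans (ler_wpM2l (exprn_ge0 b (ltW lam0)) (card_cnt_ge ord0 (n - b) lam1)).
rewrite mulrCA -exprD; apply: ler_pM => //; first exact/exprn_ge0/ltW.
  rewrite ler_nat; apply/subset_leq_card/subsetP => v; rewrite !inE wtE.
  by have := cntn v; lia.
rewrite ler_weXn2l//; lia.
Qed.

(** A union bound over d letters and two tails; [a.-1] is the value just below the window. *)
Lemma card_unbalanced a m (bound : R) :
  (forall j, #|[set k : V | (cnt j k <= a.-1)%N]|%:R <= bound) ->
  (forall j, #|[set k : V | (a + m <= cnt j k)%N]|%:R <= bound) -> (0 < a)%N ->
  #|~: balanced a m|%:R <= (2 * d)%:R * bound.
Proof.
move=> h1 h2 a0.
pose C j := [set k : V | (cnt j k <= a.-1)%N] :|: [set k : V | (a + m <= cnt j k)%N].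
have : (#|~: balanced a m| <= \sum_j #|C j|)%N.
  apply: (@leq_trans #|\bigcup_j C j|).
    apply/subset_leq_card/subsetP => k; rewrite !inE negb_forall => /existsP[j nj].
    apply/bigcupP; exists j; rewrite // !inE; lia.
  elim/big_rec2: _ => [|j u S _ IH]; first by rewrite cards0.
  by apply: leq_trans (leq_card_setU _ _) _; rewrite leq_add2l.
rewrite -(ler_nat R) => /le_trans; apply.
rewrite natr_sum natrM mulrAC; apply: (@le_trans _ _ (\sum_(j < d) 2 * bound)).
  apply: ler_sum => j _; apply: (@le_trans _ _ (#|[set k : V | (cnt j k <= a.-1)%N]|%:R +
    #|[set k : V | (a + m <= cnt j k)%N]|%:R)).
    by rewrite -natrD ler_nat leq_card_setU.
  by rewrite mulr_natl mulr2n lerD.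
by rewrite sumr_const card_ord -[leLHS]mulr_natr lexx.
Qed.
End Counting.

End Hadamard.

Lemma emb_tker_nseq (F : fieldType) (w : nat -> F) d' n :
  emb (tker (fourier w) (nseq n d'.+1))
    (fun x y : {ffun 'I_n -> 'I_d'.+1} => chi w x y).
Proof.
elim: n => [|m IH].
  apply: (emb_inj (fun=> [ffun=> ord0]) (fun=> [ffun=> ord0])); try by move=> [] [].
  by move=> x y; rewrite /chi big_ord0.
rewrite [nseq _ _]/=; apply: (emb_trans (emb_tens (emb_refl _) IH)).
pose c (x : 'I_d'.+1 * {ffun 'I_m -> 'I_d'.+1}) : {ffun 'I_m.+1 -> 'I_d'.+1} :=
  [ffun i => if unlift ord0 i is Some i' then x.2 i' else x.1].
have ci : injective c.
  move=> [x xs] [y ys] /ffunP E; congr (_, _).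
    by have := E ord0; rewrite !ffunE unlift_none.
  by apply/ffunP => i; have := E (lift ord0 i); rewrite !ffunE liftK.
apply: (emb_inj c c) => // -[x xs] [y ys].
rewrite /tens /chi big_ord_recl !ffunE !unlift_none; congr (_ * _).
by apply: eq_bigr => i _; rewrite !ffunE liftK.
Qed.

(** * Fourier matrices of prime order *)

Section PrimeFactors.
Variables (F : fieldType) (w : nat -> F).
Hypothesis wP : forall d, (0 < d)%N -> d.-primitive_root (w d).

Definition unit_block q (x y : 'I_q) : F :=
  if (x != 0 :> nat) && (y != 0 :> nat) then fourier w x y else 0.

Definition cross_block q (x y : 'I_q) : F :=
  if (x != 0 :> nat) && (y != 0 :> nat) then 0 else 1.

Lemma fourier_split q (x y : 'I_q) : fourier w x y = unit_block x y + cross_block x y.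
Proof.
rewrite /unit_block /cross_block; case: ifP => [_|]; first by rewrite addr0.
rewrite add0r /fourier; have [->|] := eqVneq (x : nat) 0%N; first by rewrite mul0n expr0.
by have [->|] := eqVneq (y : nat) 0%N; first by rewrite muln0 expr0.
Qed.

(* Indexing the units by discrete logarithms turns x y into a sum. *)
Lemma unit_block_factor q ds : prime q -> pairwise coprime ds -> all (leq 1) ds ->
  q.-1 = (\prod_(d <- ds) d)%N ->
  exists (G : 'I_q -> 'I_q -> F) (delta : 'I_q -> F), emb G (tker (fourier w) ds) /\
    forall x y, unit_block x y = \sum_k G x k * (delta k * G y k).
Proof.
move=> pq cop pos dsE; have [e [f [fp ei eM]]] := dlog wP pq.
have q1 : (0 < q.-1)%N by rewrite -subn1 subn_gt0 prime_gt1.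
have [h hE] := fourier_inversion wP q1 fp.
(* Row 0 has no logarithm, and the inner index q - 1 lies outside Z/(q-1); both go to [None], which
   gives zero lines of [G]. *)
pose fo (x : 'I_q) : option 'I_q.-1 := if x != 0 :> nat then Some (e x) else None.
pose go (k : 'I_q) : option 'I_q.-1 := insub (k : nat).
pose G (x k : 'I_q) : F :=
  match fo x, go k with Some a, Some b => fourier w a b | _, _ => 0 end.
exists G, (fun k => if go k is Some b then h b else 0); split.
  apply: (emb_trans _ (emb_fourier_prod wP cop pos dsE)).
  exists fo, go; split=> //.
    move=> x y; rewrite /fo; case: ifP => // x0; case: ifP => // y0 [E] _.
    exact: ei.
  move=> x y; rewrite /go; case: insubP => // u _ ux; case: insubP => // v _ vy [uv] _.
  by apply: val_inj; rewrite /= -ux -vy uv.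
move=> x y; rewrite /unit_block.
case: ifPn => [/andP[x0 y0]|/nandP n0]; last first.
  rewrite big1// => k _; case: n0 => /negPf n0; rewrite /G /fo.
    by rewrite n0 mul0r.
  by rewrite [in if y != 0 :> nat then _ else _]n0 !mulr0.
rewrite /fourier eM// hE.
have term (k : 'I_q) : G x k * ((if go k is Some b then h b else 0) * G y k) =
    if go k is Some b then h b * w q.-1 ^+ (b * (e x + e y)) else 0.
  rewrite /G /fo x0 y0; case: (go k) => [b|]; last by rewrite mul0r.
  by rewrite /fourier mulnDr exprD ![(b * _)%N]mulnC; ring.
under [RHS]eq_bigr do rewrite term.
rewrite /go; move: q1 (h) (e x + e y)%N (w q.-1); have := prime_gt0 pq.
case: (q) => [//|p] _ /= _ h' c z; rewrite big_ord_recr /= insubF ?ltnn// addr0.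
by apply: eq_bigr => k _; rewrite insubT//= => kp; congr (h' _ * _); apply: val_inj.
Qed.

Lemma unit_tker_factor (pps : nat -> seq nat) qs :
  (forall q, q \in qs -> [/\ prime q, pairwise coprime (pps q), all (leq 1) (pps q) &
     q.-1 = (\prod_(d <- pps q) d)%N]) ->
  exists (G : tidx qs -> tidx qs -> F) (delta : tidx qs -> F),
    emb G (tker (fourier w) (flatten (map pps qs))) /\
    forall x y, tker unit_block qs x y = \sum_k G x k * (delta k * G y k).
Proof.
elim: qs => [|q qs IH] H.
  exists (fun _ _ => 1), (fun _ => 1); split; first exact: emb_refl.
  by move=> x y /=; rewrite big_const card_unit /= !mulr1 addr0.
have [pq cop pos pE] := H q (mem_head _ _).
have [G0 [d0 [G0e G0E]]] := unit_block_factor pq cop pos pE.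
have [|G [d [Ge GE]]] := IH; first by move=> q' q'in; apply: H; rewrite inE q'in orbT.
exists (tens G0 G), (fun k => d0 k.1 * d k.2); split.
  exact: emb_trans (emb_tens G0e Ge) (emb_cat_rev _ _ _).
move=> [x xs] [y ys]; rewrite /= /tens/= G0E GE big_distrlr/= pair_bigA/=.
by apply: eq_bigr => k _; ring.
Qed.

Variable R : realFieldType.

(** Both G and delta G^T inherit the decomposition of the prime-power tensor, so their product
    doubles the rank fraction and squares the sparsity. *)
Lemma slr_unit_tker (pps : nat -> seq nat) qs (r s : R) : 0 <= r ->
  (forall q, q \in qs -> [/\ prime q, pairwise coprime (pps q), all (leq 1) (pps q) &
     q.-1 = (\prod_(d <- pps q) d)%N]) ->
  slr (tker (fourier w) (flatten (map pps qs))) r s ->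
  slr (tker unit_block qs) (r + r) (s * s).
Proof.
move=> r0 H Hs; have [G [d [Ge GE]]] := unit_tker_factor H.
have sG : slr G r s.
  apply: slr_emb Ge _ r0 Hs; rewrite !card_tidx.
  elim: (qs) H => [|q qs' IH] H /=; first by rewrite !big_nil.
  rewrite big_cat big_cons; have [_ _ _ <-] := H q (mem_head _ _).
  by apply: leq_mul; [apply: leq_pred | apply: IH => q' q'in; apply: H; rewrite inE q'in orbT].
apply: slr_ext (fun x y => esym (GE x y)) _.
apply: slr_mul => //.
apply: (@slr_ext _ _ _ _ (fun z y => d z * G y z * 1)); first by move=> *; rewrite mulr1.
exact/slr_scale/slr_tr.
Qed.

Lemma slr_cross_tker qs (qm : R) : 0 < qm -> (forall q, q \in qs -> qm <= q%:R) ->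
  slr (tker cross_block qs) ((2 / qm) ^+ size qs) 0.
Proof.
move=> qm0; elim: qs => [|q qs IH] H /=; first exact: slr_full_rank.
rewrite exprS; apply: slr_tens_low_rank; last first.
  by apply: IH => q' q'in; apply: H; rewrite inE q'in orbT.
(* The index [true] carries row 0 and [false] the rest of column 0, so the rank is at most 2 out of
   q rows. *)
apply: (@slr_low_rank _ _ _ _ bool _
  (fun (x : 'I_q) t => if t then (x == 0 :> nat)%:R else (x != 0 :> nat)%:R)
  (fun t (y : 'I_q) => if t then 1 else (y == 0 :> nat)%:R)).
  move=> x y; rewrite /cross_block big_bool /=.
  by case: eqVneq => _; case: eqVneq => _ /=; rewrite ?mulr1 ?mulr0 ?mul0r ?addr0 ?add0r.
rewrite card_bool card_ord -mulrA ler_peMr// mulrC ler_pdivlMr// mul1r.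
by apply: H; rewrite mem_head.
Qed.

(* Expand the tensor product of the blocks unit + cross. Terms with m cross factors have
   small rank, and the unit part of the other terms is handled by HP. *)
Lemma slr_expand (qs0 : seq nat) (m : nat) (qm X rP sP : R) :
  0 < qm -> 1 <= X -> 0 <= rP -> 0 <= sP ->
  (forall q, q \in qs0 -> qm <= q%:R <= X) ->
  (forall qs qs', perm_eq (qs ++ qs') qs0 -> slr (tker unit_block qs) rP sP) ->
  slr (tker (fourier w) qs0) ((size qs0).+1%:R ^+ m * (rP + (2 / qm) ^+ m))
    ((size qs0).+1%:R ^+ m * (sP * X ^+ m)).
Proof.
move=> qm0 X1 rP0 sP0 Hq HP; have X0 : 0 <= X by apply: le_trans X1.
have q20 : 0 <= 2 / qm by rewrite divr_ge0// ltW.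
(* Once m crosses are chosen, all other factors are bounded by full rank. *)
have base qs qs1 qs2 : perm_eq (qs1 ++ qs2 ++ qs) qs0 -> size qs2 = m ->
    slr (tens (tens (tker unit_block qs1) (tker cross_block qs2)) (tker (fourier w) qs))
      (rP + (2 / qm) ^+ m) (sP * X ^+ m).
  move=> P sz.
  have h2 : slr (tker cross_block qs2) ((2 / qm) ^+ m) 0.
    rewrite -sz; apply: slr_cross_tker => // q qin.
    by have /andP[] // : qm <= q%:R <= X by apply: Hq; rewrite -(perm_mem P) !mem_cat qin orbT.
  have := slr_tens_low_rank (slr_tens_low_rank (slr_full_rank _ (tker unit_block qs1)) h2)
    (slr_full_rank _ (tker (fourier w) qs)).
  apply: slr_weaken; first by rewrite mul1r mulr1 lerDr.
  by rewrite mulr_ge0// exprn_ge0.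
(* The primes in [qs1] have received the unit block, those in [qs2] the cross, those in [qs] are
   unexpanded, and j more crosses lead to [base]. *)
suff main qs qs1 qs2 j : perm_eq (qs1 ++ qs2 ++ qs) qs0 -> (size qs2 + j)%N = m ->
    slr (tens (tens (tker unit_block qs1) (tker cross_block qs2)) (tker (fourier w) qs))
      ((size qs).+1%:R ^+ j * (rP + (2 / qm) ^+ m)) ((size qs).+1%:R ^+ j * (sP * X ^+ m)).
  have /(_ (perm_refl _) erefl) := main qs0 [::] [::] m.
  apply: slr_emb.
  - apply: (emb_inj (fun x => ((tt, tt), x)) (fun x => ((tt, tt), x))); try by move=> ? ? [].
    by move=> x y; rewrite /tens/= !mul1r.
  - by rewrite !card_prod card_unit !mul1n.
  - by rewrite mulr_ge0 ?exprn_ge0// addr_ge0 ?exprn_ge0.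
elim: qs qs1 qs2 j => [|q qs IH] qs1 qs2 [|j] P sz.
- by rewrite !expr0 !mul1r; apply: base; rewrite // -sz addn0.
(* The list ends with fewer than m crosses: they are counted as dense, of size at most X^m. *)
- rewrite !expr1n !mul1r.
  have h1 := HP _ _ P.
  have := slr_tens (slr_tens h1 (slr_trivial (tker cross_block qs2)))
    (slr_trivial (tker (fourier w) [::])).
  apply: slr_weaken; first by rewrite !addr0 lerDl exprn_ge0.
  rewrite card_unit mulr1 ler_wpM2l// card_tidx.
  apply: (@le_trans _ _ (X ^+ size qs2)); last by rewrite ler_weXn2l// -sz leq_addr.
  have {P} : forall q, q \in qs2 -> q%:R <= X.
    move=> q qin; have /andP[] // : qm <= q%:R <= X.
    by apply: Hq; rewrite -(perm_mem P) !mem_cat qin orbT.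
  elim: (qs2) => [|q qs' IHq] H; first by rewrite big_nil expr0.
  rewrite big_cons natrM exprS ler_pM//; first by apply: H; rewrite mem_head.
  by apply: IHq => q' q'in; apply: H; rewrite inE q'in orbT.
- by rewrite !expr0 !mul1r; apply: base; rewrite // -sz addn0.
set a := (size qs).+1%:R in IH; set B := rP + _ in IH *; set S := sP * _ in IH *.
have B0 : 0 <= B by rewrite addr_ge0 ?exprn_ge0.
have S0 : 0 <= S by rewrite mulr_ge0 ?exprn_ge0.
(* The number of terms is controlled by (k+1)^(j+1) + (k+1)^j <= (k+2)^(j+1). *)
have grow (t : R) : 0 <= t -> a ^+ j.+1 * t + a ^+ j * t <= (size (q :: qs)).+1%:R ^+ j.+1 * t.
  move=> t0; rewrite -mulrDl ler_wpM2r// exprSr -[X in _ + X]mulr1 -mulrDr natr1 exprSr.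
  by rewrite ler_wpM2r// lerXn2r ?nnegrE ?ler_nat.
have h1 := IH (q :: qs1) qs2 j.+1 _ sz.
have h2 := IH qs1 (q :: qs2) j _ _.
apply: slr_weaken (grow _ B0) (grow _ S0) _.
have Pq1 : perm_eq ((q :: qs1) ++ qs2 ++ qs) qs0.
  apply: perm_trans P; have /permPl := perm_catCA [:: q] (qs1 ++ qs2) qs.
  by rewrite -!catA.
have Pq2 : perm_eq (qs1 ++ (q :: qs2) ++ qs) qs0.
  apply: perm_trans P; rewrite perm_cat2l; have /permPl := perm_catCA [:: q] qs2 qs.
  by [].
have sz2 : (size (q :: qs2) + j = m)%N by rewrite /= addSnnS.
pose fP (x : (tidx qs1 * tidx qs2) * ('I_q * tidx qs)) := ((x.2.1, x.1.1), x.1.2, x.2.2).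
pose fQ (x : (tidx qs1 * tidx qs2) * ('I_q * tidx qs)) := (x.1.1, (x.2.1, x.1.2), x.2.2).
apply: slr_ext (slr_add
  (slr_emb (K := fun x y => tens (tens (tker unit_block (q :: qs1)) (tker cross_block qs2))
     (tker (fourier w) qs) (fP x) (fP y)) _ _ _ (h1 Pq1))
  (slr_emb (K := fun x y => tens (tens (tker unit_block qs1) (tker cross_block (q :: qs2)))
     (tker (fourier w) qs) (fQ x) (fQ y)) _ _ _ (h2 Pq2 sz2))).
- move=> [[x1 x2] [x x3]] [[y1 y2] [y y3]]; rewrite /tens /= /tens /= fourier_split; ring.
- apply: (emb_inj fP fP) => //;
    by move=> [[? ?] [? ?]] [[? ?] [? ?]] [-> -> -> ->].
- by rewrite /= !card_prod; apply: eq_leq; ring.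
- by rewrite mulr_ge0 ?exprn_ge0.
- apply: (emb_inj fQ fQ) => //;
    by move=> [[? ?] [? ?]] [[? ?] [? ?]] [-> -> -> ->].
- by rewrite /= !card_prod; apply: eq_leq; ring.
- by rewrite mulr_ge0 ?exprn_ge0.
Qed.
End PrimeFactors.

(** * Quantitative estimates *)

Lemma dft_root_exp (R : realType) d k :
  dft_root R d ^+ k = (cos (k%:R * (2 * pi / d%:R)) +i* sin (k%:R * (2 * pi / d%:R)))%C.
Proof.
elim: k => [|k IH]; first by rewrite expr0 mul0r cos0 sin0.
rewrite exprS IH /dft_root; set t := 2 * pi / d%:R.
rewrite -[k.+1%:R]natr1 mulrDl mul1r [_ + t]addrC cosD sinD.
by apply/eqP; rewrite eq_complex /= eqxx addrC eqxx.
Qed.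

Lemma dft_root_primitive (R : realType) d : (0 < d)%N -> d.-primitive_root (dft_root R d).
Proof.
move=> d0; have d0' : 0 < d%:R :> R by rewrite ltr0n.
rewrite /primitive_root_of_unity d0; apply/forallP => i; apply/eqP.
rewrite unity_rootE dft_root_exp.
have [->|ne] := eqVneq i.+1 d.
  rewrite (_ : d%:R * _ = pi *+ 2); last by rewrite -mulr_natl; field; rewrite gt_eqF.
  by rewrite cos2pi sin2pi eqxx.
apply/negP => /eqP[/eqP + _]; apply/negP.
have lti : (i.+1 < d)%N by rewrite ltn_neqAle ne ltn_ord.
(* The half angle lies strictly between 0 and pi, where sin t > 0, so cos(2t) = 1 - 2 sin(t)^2
   differs from 1. *)
pose t : R := i.+1%:R * pi / d%:R.
have -> : i.+1%:R * (2 * pi / d%:R) = t *+ 2 :> R by rewrite /t -mulr_natl; field; rewrite gt_eqF.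
have t0 : 0 < sin t.
  apply: sin_gt0_pi; rewrite /t divr_gt0 ?mulr_gt0 ?pi_gt0 ?ltr0n//=.
  by rewrite ltr_pdivrMr// mulrC ltr_pM2l ?pi_gt0// ltr_nat.
rewrite cos_mulr2n cos2sin2; apply/eqP => E.
have : sin t ^+ 2 = 0 by move: E; rewrite -mulr_natl; lra.
by move/eqP; rewrite expf_eq0 /= gt_eqF.
Qed.

(** * Chernoff bounds for tensor powers of Fourier matrices *)

Section Chernoff.
Variable R : realType.

(** From e^(-t) >= 1 - t follows e^t <= 1/(1 - t); the rest is algebra on the interval. *)
Lemma expR_le_quadratic (t : R) : -1 / 2 <= t <= 1 / 2 -> expR t <= 1 + t + 2 * t ^+ 2.
Proof.
move=> /andP[h1 h2]; have p : 0 < 1 - t by lra.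
have h : 1 - t <= expR (- t) by have := expR_ge1Dx (- t).
rewrite -[expR t]invrK -expRN; apply: (@le_trans _ _ (1 - t)^-1).
  by rewrite lef_pV2 ?posrE ?expR_gt0.
rewrite invf_ple ?posrE//; last by nra.
rewrite -[X in X <= _]mul1r ler_pdivrMr; nra.
Qed.

(** With d = d' + 1, write (e^t + d')/d = 1 + (e^t - 1)/d and use 1 + s <= e^s. *)
Lemma pow_le_exp (d' n : nat) (t : R) : -1 / 2 <= t <= 1 / 2 ->
  (expR t + d'%:R) ^+ n <=
    d'.+1%:R ^+ n * expR ((t + 2 * t ^+ 2) * (n%:R / d'.+1%:R)).
Proof.
move=> ht; have d0 : 0 < d'.+1%:R :> R by rewrite ltr0n.
rewrite mulrCA expRM_natl -exprMn lerXn2r ?nnegrE//.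
- by rewrite addr_ge0 ?expR_ge0.
- by rewrite mulr_ge0 ?expR_ge0.
apply: le_trans (ler_wpM2l (ltW d0) (expR_ge1Dx _)).
rewrite mulrDr mulr1 [X in _ <= _ + X]mulrC divfK ?gt_eqF// -natr1.
by have := expR_le_quadratic ht; lra.
Qed.

(* Exponential moments with parameter eta / 4. *)
Lemma slr_fourier_power (F : fieldType) (w : nat -> F)
    (wP : forall d, (0 < d)%N -> d.-primitive_root (w d)) (d n : nat) (eta : R) :
  (1 < d)%N -> (0 < n)%N -> 0 < eta <= 1 ->
  slr (tker (fourier w) (nseq n d)) (2 * d%:R * expR (- (eta ^+ 2 * n%:R / (8 * d%:R))))
    (expR (1 + (2 * eta * n%:R + d%:R) * ln (n%:R * d%:R))).
Proof.
case: d => [//|d'] d1 n0 /andP[eta0 eta1]; set d := d'.+1.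
have d0 : 0 < d%:R :> R by rewrite ltr0n.
have n0' : 0 < n%:R :> R by rewrite ltr0n.
pose r : R := n%:R / d%:R; have r0 : 0 < r by rewrite divr_gt0.
(* The mean count is r = n/d. Since a - 1 <= (1 - eta) r and a + m >= (1 + eta) r, counts outside
   the window deviate from it by at least eta r. *)
pose a := (Num.truncn ((1 - eta) * r)).+1.
pose m := (Num.truncn (2 * eta * r)).+1.
have aE : a.-1%:R <= (1 - eta) * r.
  by rewrite /a /= truncn_le mulr_ge0 ?(ltW r0)// subr_ge0.
have mE : m%:R <= 2 * eta * r + 1.
  rewrite /m -[_.+1%:R]natr1 lerD2r truncn_le; apply: mulr_ge0 (ltW r0); lra.
have amE : (1 + eta) * r <= (a + m)%:R.
  have h1 : (1 - eta) * r < a%:R by apply: truncnS_gt.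
  have h2 : 2 * eta * r < m%:R by apply: truncnS_gt.
  rewrite natrD; nra.
pose V : finType := {ffun 'I_n -> 'I_d}.
have cV : #|V|%:R = d%:R ^+ n :> R by rewrite card_ffun !card_ord natrX.
pose bound := d%:R ^+ n * expR (- (eta ^+ 2 * n%:R / (8 * d%:R))).
have boundE : bound = d%:R ^+ n * expR (- (eta ^+ 2 / 8 * r)).
  by congr (_ * expR _); rewrite /r; field; rewrite gt_eqF.
have dn0 : 0 < d%:R ^+ n :> R by rewrite exprn_gt0.
(* With t = -eta/4 the exponent per unit of r is (t + 2 t^2) - t (1 - eta) = -eta^2/8; [upper] is
   symmetric with t = eta/4. *)
have lower j : #|[set k : V | (cnt j k <= a.-1)%N]|%:R <= bound.
  have := @card_cnt_le d' n R (expR (- (eta / 4))) j a.-1.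
  rewrite expR_ge0 expR_le1 oppr_le0 divr_ge0 ?(ltW eta0)//= => /(_ isT).
  move=> /le_trans/(_ (pow_le_exp _ _ _)); rewrite -expRM_natl => /(_ ltac:(lra)).
  rewrite -ler_pdivlMr ?expR_gt0// => /le_trans; apply.
  rewrite -mulrA -expRN -expRD boundE ler_wpM2l ?(ltW dn0)// ler_expR -/d -/r.
  nra.
have upper j : #|[set k : V | (a + m <= cnt j k)%N]|%:R <= bound.
  have := @card_cnt_ge d' n R (expR (eta / 4)) j (a + m).
  rewrite -[leLHS]expR0 ler_expR divr_ge0 ?(ltW eta0)//= => /(_ isT).
  move=> /le_trans/(_ (pow_le_exp _ _ _)); rewrite -expRM_natl => /(_ ltac:(lra)).
  rewrite -ler_pdivlMr ?expR_gt0// => /le_trans; apply.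
  rewrite -mulrA -expRN -expRD boundE ler_wpM2l ?(ltW dn0)// ler_expR -/d -/r.
  nra.
have H := @slr_hadamard F w wP d' n R a m n0.
apply: (slr_emb (emb_tker_nseq w d' n)).
- by rewrite card_tidx card_ffun !card_ord big_nseq iter_muln muln1.
- by rewrite !mulr_ge0 ?expR_ge0// ltW.
apply: slr_weaken H.
  rewrite ler_pdivrMr ?cV//; apply: le_trans (card_unbalanced lower upper _) _ => //.
  by rewrite /bound natrM [d%:R ^+ n * _]mulrC mulrA lexx.
have nd1 : 1 <= n%:R * d%:R :> R by rewrite -natrM ler1n muln_gt0 n0.
have nd0 : 0 < n%:R * d%:R :> R by apply: lt_le_trans nd1.
(* With lam = n d the second factor is at most (1 + 1/n)^n <= e, and d m <= 2 eta n + d. *)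
apply: le_trans (card_wt_le _ _ _ nd1) _.
rewrite expRD mulrC ler_pM ?exprn_ge0 ?(ltW nd0)//.
- by rewrite addr_ge0// divr_ge0// ltW.
- apply: (@le_trans _ _ (expR (n%:R^-1) ^+ n)).
    rewrite lerXn2r ?nnegrE ?expR_ge0//.
      by rewrite addr_ge0// divr_ge0// ltW.
    apply: le_trans (expR_ge1Dx _); rewrite lerD2l ler_pdivrMr// mulKf ?gt_eqF//.
    by rewrite ler_nat.
  by rewrite -expRM_natl mulfV ?gt_eqF.
- rewrite -[X in X ^+ _]lnK ?posrE// -expRM_natl ler_expR ler_wpM2r ?ln_ge0//.
  rewrite natrM; apply: (@le_trans _ _ (d%:R * (2 * eta * r + 1))).
    by rewrite ler_wpM2l// ltW.
  by rewrite /r le_eqVlt; apply/orP; left; apply/eqP; field; rewrite gt_eqF.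
Qed.

(** Equal entries are grouped. A value occurring fewer than Th times is dense, of size at most
    exp(Th Lam). For the others [slr_fourier_power] applies, and d <= D <= eta Th <= eta n turns 2
    eta n + d into 3 eta n. *)
Lemma slr_fourier_list (F : fieldType) (w : nat -> F)
    (wP : forall d, (0 < d)%N -> d.-primitive_root (w d)) (D T : nat) (eta Th Lam : R) ds :
  0 < eta <= 1 -> 0 <= Th -> 0 <= Lam -> D%:R <= eta * Th -> ln (T%:R * D%:R) <= Lam ->
  all (fun d => 2 <= d <= D)%N ds -> (size ds <= T)%N ->
  slr (tker (fourier w) ds) (D%:R * (2 * D%:R * expR (- (eta ^+ 2 * Th / (8 * D%:R)))))
    (expR (D%:R * (1 + Th * Lam) + 3 * eta * Lam * (size ds)%:R)).
Proof.
move=> eta01 Th0 Lam0 DTh lnTD dsD szT; have /andP[eta0 eta1] := eta01.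
rewrite expRD expRM_natl [expR (_ * (size ds)%:R)]expRM_natr.
apply: slr_group => //.
- by rewrite !mulr_ge0 ?expR_ge0.
- by rewrite -[leLHS]expR0 ler_expR addr_ge0// mulr_ge0.
move=> d n /andP[d2 dD] nsz; rewrite -expRM_natr -expRD.
have d0 : 0 < d%:R :> R by rewrite ltr0n (leq_trans _ d2).
have D0 : 0 < D%:R :> R by apply: lt_le_trans d0 _; rewrite ler_nat.
have dD' : d%:R <= D%:R :> R by rewrite ler_nat.
have elam : 0 <= 3 * eta * Lam by rewrite !mulr_ge0 ?(ltW eta0).
have [nTh|Thn] := ltP n%:R Th.
  have := slr_trivial (R := R) (tker (fourier w) (nseq n d)).
  rewrite card_tidx big_nseq iter_muln muln1; apply: slr_weaken.
    by rewrite !mulr_ge0 ?expR_ge0.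
  rewrite natrX -[d%:R]lnK ?posrE// -expRM_natl ler_expR.
  apply: (@le_trans _ _ (Th * Lam)); last first.
    by rewrite -addrA addrCA lerDl addr_ge0// mulr_ge0.
  have [->|n0] := posnP n; first by rewrite mul0r mulr_ge0.
  have T1 : 1 <= T%:R :> R by rewrite ler1n (leq_trans n0) ?(leq_trans nsz).
  apply: ler_pM => //; [by apply: ln_ge0; rewrite ler1n (leq_trans _ d2)|exact: ltW|].
  apply: le_trans lnTD; rewrite ler_ln ?posrE//; last by rewrite mulr_gt0// (lt_le_trans ltr01).
  by apply: le_trans dD' _; rewrite ler_peMl// ltW.
have n0 : (0 < n)%N.
  rewrite lt0n; apply/eqP => n0; move: Thn DTh; rewrite n0 => Th0'.
  have -> : Th = 0 by apply/eqP; rewrite eq_le Th0 Th0'.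
  by rewrite mulr0 leNgt D0.
have n0' : 0 < n%:R :> R by rewrite ltr0n.
have T0 : 0 < T%:R :> R by rewrite ltr0n (leq_trans n0) ?(leq_trans nsz).
apply: slr_weaken (slr_fourier_power wP d2 n0 eta01).
  apply: ler_pM => //; [by rewrite mulr_ge0|by rewrite expR_ge0|by rewrite ler_wpM2l|].
  rewrite ler_expR lerN2; apply: ler_pM.
  - by rewrite mulr_ge0 ?sqr_ge0.
  - by rewrite invr_ge0 mulr_ge0// ltW.
  - by rewrite ler_wpM2l ?sqr_ge0.
  - by rewrite lef_pV2 ?posrE ?mulr_gt0// ler_wpM2l.
rewrite ler_expR -addrA lerD2l -[leLHS]add0r lerD ?mulr_ge0//.
have -> : 3 * eta * Lam * n%:R = (3 * eta * n%:R) * Lam by ring.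
apply: ler_pM.
- by rewrite addr_ge0 ?mulr_ge0 ?(ltW eta0).
- by apply: ln_ge0; rewrite -natrM ler1n muln_gt0 n0 (leq_trans _ d2).
- have : eta * Th <= eta * n%:R by rewrite ler_wpM2l// ltW.
  lra.
- apply: le_trans lnTD; rewrite ler_ln ?posrE ?mulr_gt0// ler_pM// ler_nat.
  exact: leq_trans nsz szT.
Qed.

End Chernoff.

(** * Prime powers of q - 1 and the resulting bound for DFT_N *)

Definition prime_powers (n : nat) : seq nat := [seq (p ^ logn p n)%N | p <- primes n].

Lemma prod_prime_powers n : (0 < n)%N -> n = (\prod_(d <- prime_powers n) d)%N.
Proof. by move=> n0; rewrite {1}(prod_prime_decomp n0) prime_decompE !big_map. Qed.

Lemma prime_powers_ge2 n : all (leq 2) (prime_powers n).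
Proof.
rewrite all_map; apply/allP => p /= pn; move: (pn); rewrite mem_primes => /and3P[pp n0 pdn].
apply: leq_trans (prime_gt1 pp) _; rewrite -[leqLHS]expn1 leq_exp2l ?prime_gt1//.
by rewrite logn_gt0.
Qed.

Lemma prime_powers_coprime n : pairwise coprime (prime_powers n).
Proof.
rewrite pairwise_map; have := primes_uniq n; rewrite uniq_pairwise.
apply: (@sub_in_pairwise _ (fun p => p \in primes n)); last exact/allP.
move=> p r /= pP rP npr.
have pp : prime p by have := pP : p \in primes n; rewrite mem_primes => /andP[].
have pr : prime r by have := rP : r \in primes n; rewrite mem_primes => /andP[].
by rewrite coprimeXl// coprimeXr// prime_coprime// dvdn_prime2.
Qed.

(** The quadratic bound at 1/2 gives e^(1/2) <= 1 + 1/2 + 1/2 = 2. *)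
Lemma ln2_ge_half (R : realType) : 1 / 2 <= ln 2 :> R.
Proof.
rewrite -[leLHS]expRK ler_ln ?posrE ?expR_gt0//.
by apply: le_trans (expR_le_quadratic _) _; lra.
Qed.

Lemma pow2_size_le (ds : seq nat) : all (leq 2) ds -> (2 ^ size ds <= \prod_(d <- ds) d)%N.
Proof.
elim: ds => [|d ds IH] /=; first by rewrite big_nil.
by rewrite big_cons expnS => /andP[d2 /IH]; apply: leq_mul.
Qed.

(** [slr_fourier_list] is applied to the prime powers of all q - 1, and [m] is the cutoff on
    crosses. The outer factor 2 in rank and in the exponent comes from the product G delta G^T. *)
Lemma slr_dft_smooth (R : realType) (F : fieldType) (w : nat -> F)
    (wP : forall d, (0 < d)%N -> d.-primitive_root (w d))
    (qs : seq nat) (qm X eta Th Lam : R) (D m : nat) :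
  let N := (\prod_(q <- qs) q)%N in
  0 < qm -> 1 <= X -> 0 < eta <= 1 -> 0 <= Th -> 0 <= Lam -> D%:R <= eta * Th ->
  ln ((Num.truncn (2 * ln N%:R : R))%:R * D%:R) <= Lam ->
  (forall q, q \in qs -> [/\ prime q, qm <= q%:R <= X & all (geq D) (prime_powers q.-1)]) ->
  slr (tker (fourier w) qs)
    ((size qs).+1%:R ^+ m *
      (2 * (D%:R * (2 * D%:R * expR (- (eta ^+ 2 * Th / (8 * D%:R))))) + (2 / qm) ^+ m))
    ((size qs).+1%:R ^+ m *
      (expR (2 * (D%:R * (1 + Th * Lam) + 6 * eta * Lam * ln N%:R)) * X ^+ m)).
Proof.
move=> N qm0 X1 eta01 Th0 Lam0 DTh lnTD Hq; have /andP[eta0 eta1] := eta01.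
have prime_gt1' q : q \in qs -> (1 < q)%N by move=> /Hq[/prime_gt1].
have N0 : (0 < N)%N by rewrite /N big_seq; apply: prodn_cond_gt0 => q /prime_gt1'/ltnW.
have lnN0 : 0 <= ln N%:R :> R by apply: ln_ge0; rewrite ler1n.
apply: slr_expand => //.
- by rewrite !mulr_ge0 ?expR_ge0.
- by rewrite expR_ge0.
- by move=> q /Hq[].
move=> s s' P.
have sq q : q \in s -> q \in qs by move=> qs1; rewrite -(perm_mem P) mem_cat qs1.
have Hs q : q \in s -> [/\ prime q, pairwise coprime (prime_powers q.-1),
    all (leq 1) (prime_powers q.-1) & q.-1 = (\prod_(d <- prime_powers q.-1) d)%N].
  move=> /sq qin; have [pq _ _] := Hq q qin; split=> //.
  - exact: prime_powers_coprime.
  - by apply: sub_all (prime_powers_ge2 _) => d; apply: ltnW.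
  - by apply: prod_prime_powers; rewrite -subn1 subn_gt0 prime_gt1.
pose ds := flatten (map (fun q => prime_powers q.-1) s).
have ds2 : all (leq 2) ds.
  by apply/allP => d /flatten_mapP[q _]; apply/allP/prime_powers_ge2.
have dsD : all (fun d => 2 <= d <= D)%N ds.
  apply/allP => d dP; rewrite (allP ds2 _ dP) /=.
  by case/flatten_mapP: dP => q /sq qin; have [_ _ /allP h] := Hq q qin => /h.
(* All entries are at least 2 and their product is at most N, so there are at most 2 ln N of
   them. *)
have szN : (2 ^ size ds <= N)%N.
  apply: leq_trans (pow2_size_le ds2) _.
  have -> : N = ((\prod_(q <- s) q) * \prod_(q <- s') q)%N by rewrite -big_cat /N (perm_big _ P).
  have p0 : (0 < \prod_(q <- s') q)%N.
    rewrite big_seq; apply: prodn_cond_gt0 => q qin.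
    by apply/ltnW/prime_gt1'; rewrite -(perm_mem P) mem_cat qin orbT.
  apply: leq_trans (leq_pmulr _ p0); rewrite /ds.
  elim: (s) Hs => [|q s1 IH] H /=; first by rewrite !big_nil.
  rewrite big_cat big_cons; have [_ _ _ <-] := H q (mem_head _ _).
  by apply: leq_mul; [apply: leq_pred | apply: IH => q' q'in; apply: H; rewrite inE q'in orbT].
have szln : (size ds)%:R <= 2 * ln N%:R :> R.
  have : ln (2 ^+ size ds) <= ln N%:R :> R.
    by rewrite ler_ln ?posrE ?exprn_gt0 ?ltr0n// -natrX ler_nat.
  rewrite lnXn// -[ln 2 *+ _]mulr_natr; have := ln2_ge_half R; have : 0 <= (size ds)%:R :> R by [].
  nra.
have := slr_fourier_list wP eta01 Th0 Lam0 DTh lnTD dsD.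
rewrite truncn_ge_nat ?mulr_ge0// => /(_ szln) H.
have r0 : 0 <= D%:R * (2 * D%:R * expR (- (eta ^+ 2 * Th / (8 * D%:R)))) :> R.
  by rewrite !mulr_ge0 ?expR_ge0.
apply: slr_weaken (slr_unit_tker wP r0 Hs H); first by rewrite [leRHS]mulr_natl mulr2n.
rewrite -expRD ler_expR.
have : 3 * eta * Lam * (size ds)%:R <= 3 * eta * Lam * (2 * ln N%:R).
  by rewrite ler_wpM2l// !mulr_ge0// ltW.
lra.
Qed.

Lemma rigidity_le_slr (R : realType) (N : nat) (rho s r : R) : 0 <= r -> rho * N%:R <= r ->
  slr (@fourier _ (dft_root R) N) rho s -> (rigidity (DFT R N) r)%:R <= s.
Proof.
move=> r0 rhoN [A [n [T [u [v [HK [Hr Hc] Hn HT]]]]]].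
apply: le_trans Hn; rewrite ler_nat; apply: (rigidityP (DFT R N) r0).2.
pose U := \matrix_(i < N, t < #|T|) u i (enum_val t).
pose V := \matrix_(t < #|T|, j < N) v (enum_val t) j.
exists (\matrix_(i, j) A i j), (U *m V); split.
- apply/matrixP => i j; rewrite !mxE -[LHS]/(fourier _ i j) HK; congr (_ + _).
  rewrite (reindex_onto (@enum_val T T) enum_rank) /=; last by move=> t _; apply: enum_rankK.
  by apply: eq_big => [t|t _]; rewrite ?enum_valK ?eqxx// !mxE.
- split=> z; [apply: leq_trans (Hr z) | apply: leq_trans (Hc z)];
  by apply/subset_leq_card/subsetP => i; rewrite !inE mxE.
- apply: le_trans rhoN; rewrite card_ord in HT; apply: le_trans HT.
  by rewrite ler_nat mulmx_max_rank.
Qed.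

(* exp t dominates t^(k+1) / (k+1)!. *)
Lemma ln_powR_le_powR (R : realType) (a c : R) :
  exists x1 : R, forall x, x1 < x -> c * (ln x) `^ a <= x `^ (200%:R^-1).
Proof.
have [k ak] : exists k : nat, a <= k%:R.
  by exists (Num.truncn a).+1; apply/ltW/truncnS_gt.
(* Once L = ln x is at least c M, the exponential term L^(k+1) / M is at least c L^k. *)
pose M : R := 200 ^+ k.+1 * k.+1`!%:R; have M0 : 0 < M.
  by rewrite mulr_gt0 ?exprn_gt0// ltr0n fact_gt0.
exists (expR (Num.max 1 (c * M))) => x hx.
have x0 : 0 < x by apply: lt_trans hx; apply: expR_gt0.
have /andP[L1 LM] : (1 <= ln x) && (c * M <= ln x).
  by rewrite -ge_max -[leLHS]expRK ler_ln ?posrE ?expR_gt0// ltW.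
have L0 : 0 < ln x by apply: lt_le_trans L1.
have [c0|c0] := leP c 0.
  by apply: (@le_trans _ _ 0); rewrite ?powR_ge0// mulr_le0_ge0// powR_ge0.
have -> : x `^ 200^-1 = expR (ln x / 200) by rewrite /powR gt_eqF// mulrC.
have h : 0 <= ln x / 200 by rewrite divr_ge0// ltW.
apply: (@le_trans _ _ ((ln x / 200) ^+ k.+1 / k.+1`!%:R)); last first.
  by apply: le_trans (expR_ge1Dxn k h); rewrite lerDr.
apply: (@le_trans _ _ (c * ln x ^+ k)).
  by rewrite ler_wpM2l ?(ltW c0)// -powR_mulrn ?(ltW L0)// ler_powR.
rewrite expr_div_n -mulrA -invfM -/M ler_pdivlMr// exprS.
by rewrite mulrAC ler_wpM2r ?exprn_ge0 ?(ltW L0).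
Qed.

(** * Asymptotics in x, with y = x^(1/200) and L = ln x *)

Section Asymptotics.
Variable R : realFieldType.
Implicit Types y L : R.

(** Here Th = y^138, eta = 1/y and Lam = 2L. Every term is at most a multiple of (n/y) L, with
    constants adding up to 18 + 24 = 42, and 6 L <= eps y turns 42 (n/y) L into 7 eps n. *)
Lemma sparsity_exponent (y L n eps D m : R) :
  100 <= y -> 1 <= L -> 6 * L <= eps * y -> y ^+ 199 <= 2 * n ->
  0 <= D <= y ^+ 60 -> 0 <= m <= 2 * y ^+ 74 ->
  3 * m * L + 2 * (D * (1 + y ^+ 138 * (2 * L)) + 6 * y^-1 * (2 * L) * n) <= 7 * eps * n.
Proof.
move=> y100 L1 Ly yn /andP[D0 Dy] /andP[m0 my].
have y0 : 0 < y by apply: lt_le_trans y100.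
have y1 : 1 <= y by apply: le_trans y100; rewrite ler1n.
have L0 : 0 <= L by apply: le_trans L1.
have n0 : 0 <= n by have := exprn_ge0 199 (ltW y0); lra.
pose P := y ^+ 198.
have mP : m <= P.
  apply: le_trans my _; apply: (@le_trans _ _ (y ^+ 75)); last by rewrite /P ler_weXn2l.
  by rewrite [y ^+ 75]exprS ler_wpM2r ?exprn_ge0 ?(ltW y0)//; lra.
have DP : D * (1 + y ^+ 138 * (2 * L)) <= 3 * P * L.
  have -> : 3 * P * L = y ^+ 60 * (3 * y ^+ 138 * L) by rewrite /P (exprD y 60 138); ring.
  have h : 1 <= y ^+ 138 * L by rewrite -[leLHS]mulr1 ler_pM// exprn_ege1.
  apply: ler_pM => //; last by lra.
  by rewrite addr_ge0// mulr_ge0 ?exprn_ge0 ?(ltW y0)// mulr_ge0.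
have Pn : P <= 2 * (n / y).
  by rewrite mulrA ler_pdivlMr// /P -exprSr.
have mL : m * L <= P * L by rewrite ler_wpM2r.
have PL : P * L <= 2 * (n / y) * L by rewrite ler_wpM2r.
have nL : 6 * (n / y) * L <= eps * n.
  have -> : eps * n = n / y * (eps * y) by field; rewrite gt_eqF.
  have -> : 6 * (n / y) * L = n / y * (6 * L) by ring.
  by rewrite ler_wpM2l// divr_ge0// ltW.
have -> : 6 * y^-1 * (2 * L) * n = 12 * ((n / y) * L) by ring.
lra.
Qed.

(** The gain is at least y^76/8, against a loss of at most 4 y^74 L <= y^75/25 from the number of
    terms. The target y^73 bounds n^0.36 for n <= y^202. *)
Lemma rank_exponent (y L D m : R) :
  100 <= y -> 1 <= L -> 100 * L <= y -> 1 <= D <= y ^+ 60 -> m <= 2 * y ^+ 74 ->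
  2 * m * L + 3 + L - y^-1 ^+ 2 * y ^+ 138 / (8 * D) <= - y ^+ 73 - 1.
Proof.
move=> y100 L1 Ly /andP[D1 Dy] my.
have y0 : 0 < y by apply: lt_le_trans y100.
have y1 : 1 <= y by apply: le_trans y100; rewrite ler1n.
have D0 : 0 < D by apply: lt_le_trans D1.
have E : y ^+ 76 / 8 <= y^-1 ^+ 2 * y ^+ 138 / (8 * D).
  have -> : y^-1 ^+ 2 * y ^+ 138 / (8 * D) = y ^+ 136 / D / 8.
    by rewrite (exprD y 2 136); field; rewrite !gt_eqF.
  rewrite ler_wpM2r ?invr_ge0// ler_pdivlMr// (exprD y 76 60).
  by rewrite ler_wpM2l// exprn_ge0// ltW.
have mL : m * L <= 2 * y ^+ 74 * L by rewrite ler_wpM2r//; lra.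
have yL : 2 * y ^+ 74 * L * 100 <= 2 * y ^+ 75.
  rewrite [y ^+ 75]exprSr.
  have -> : 2 * y ^+ 74 * L * 100 = 2 * (y ^+ 74 * (100 * L)) by ring.
  by rewrite !ler_wpM2l// exprn_ge0// ltW.
have h76 : 100 * y ^+ 75 <= y ^+ 76 by rewrite [y ^+ 76]exprS ler_wpM2r// exprn_ge0// ltW.
have h73 : y ^+ 73 <= y ^+ 75 by rewrite ler_weXn2l.
have h1 : y <= y ^+ 75 by rewrite -[leLHS]expr1 ler_weXn2l.
lra.
Qed.
End Asymptotics.

Lemma truncnS_le_double (R : realType) (t : R) : 1 <= t -> (Num.truncn t).+1%:R <= 2 * t.
Proof.
move=> t1; have : (Num.truncn t)%:R <= t by rewrite truncn_le (le_trans _ t1).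
rewrite -[_.+1%:R]natr1; lra.
Qed.

(** The number of choices per cross is beaten by its rank fraction: c (2/qm) <= 4 l/qm <= 4/64,
    which is at most e^(-2) as e^(1/2) <= 2. *)
Lemma cross_rank_estimate (R : realType) (L c l qm : R) (m : nat) :
  8 <= L -> 0 <= c <= 2 * l -> 0 < qm -> l / qm <= L ^- 10 ->
  c ^+ m * (2 / qm) ^+ m <= expR (m%:R * - 2).
Proof.
move=> L8 /andP[c0 cl] qm0 lqm.
rewrite -exprMn expRM_natl lerXn2r ?nnegrE ?expR_ge0//.
  by rewrite mulr_ge0// divr_ge0// ltW.
have h3 : L ^- 10 <= (1 / 64 : R).
  have L0 : 0 < L by apply: lt_le_trans L8.
  rewrite mul1r lef_pV2 ?posrE ?exprn_gt0//; apply: (@le_trans _ _ (L ^+ 2)).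
    by rewrite expr2; nra.
  by rewrite ler_weXn2l// (le_trans _ L8)// ler1n.
have h4 : (1 / 16 : R) <= expR (- 2).
  rewrite mul1r expRN lef_pV2 ?posrE ?expR_gt0//.
  have -> : 2 = 4%:R * (1 / 2) :> R by field.
  rewrite expRM_natl; apply: (@le_trans _ _ (2 ^+ 4)); last by rewrite -natrX ler_nat.
  rewrite lerXn2r ?nnegrE ?expR_ge0//; apply: le_trans (expR_le_quadratic _) _; lra.
apply: le_trans h4; apply: (@le_trans _ _ (2 * l * (2 / qm))).
  by rewrite ler_wpM2r// divr_ge0// ltW.
have -> : 2 * l * (2 / qm) = 4 * (l / qm) by ring.
lra.
Qed.

Lemma rank_estimate (R : realType) (y L n eps D c l qm : R) (m : nat) :
  100 <= y -> 8 <= L -> 100 * L <= y -> expR L = y ^+ 200 -> 0 <= n <= y ^+ 202 ->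
  0 < eps <= 1 -> 1 <= D <= y ^+ 60 -> y ^+ 74 <= m%:R <= 2 * y ^+ 74 ->
  0 <= c <= 2 * l -> c ^+ m <= expR (2 * m%:R * L) -> 0 < qm -> l / qm <= L ^- 10 ->
  c ^+ m * (2 * (D * (2 * D * expR (- (y^-1 ^+ 2 * y ^+ 138 / (8 * D))))) + (2 / qm) ^+ m)
    <= expR (- (eps ^+ 6 * n `^ (36%:R / 100%:R))).
Proof.
move=> y100 L8 Ly LE /andP[n0 n_le] /andP[eps0 eps1] D_bd /andP[m_ge m_le] c_bd cm qm0 lqm.
have /andP[D_ge D_le] := D_bd; have /andP[c0 _] := c_bd.
have y0 : 0 < y by apply: lt_le_trans y100.
have y1 : 1 <= y by apply: le_trans y100; rewrite ler1n.
have yX k : 0 < y ^+ k by rewrite exprn_gt0.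
have D0 : 0 <= D by apply: le_trans D_ge.
(* Both summands will be at most [expR u], and the -1 absorbs their doubling since e >= 2. *)
pose u := - y ^+ 73 - 1.
have uE : expR u + expR u <= expR (- (eps ^+ 6 * n `^ (36%:R / 100%:R))).
  apply: (@le_trans _ _ (expR (- y ^+ 73))).
    have -> : - y ^+ 73 = u + 1 by rewrite /u subrK.
    have e1 : 2 <= expR 1 :> R by have := expR_ge1Dx (1 : R).
    by rewrite (expRD u); apply: le_trans (ler_wpM2l (expR_ge0 u) e1); rewrite mulr_natr mulr2n.
  rewrite ler_expR lerN2; apply: (@le_trans _ _ (n `^ (36%:R / 100%:R))).
    by rewrite -[leRHS]mul1r ler_wpM2r ?powR_ge0// exprn_ile1 ?(ltW eps0).
  apply: (@le_trans _ _ ((y ^+ 202) `^ (36%:R / 100%:R))).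
    by rewrite ge0_ler_powR ?nnegrE ?(ltW (yX _))// divr_ge0.
  (* The exponents compare as 202 times 0.36 = 72.72 <= 73. *)
  rewrite -!powR_mulrn ?(ltW y0)// -powRrM ler_powR//.
  by rewrite mulrA ler_pdivrMr// -!natrM ler_nat.
apply: le_trans uE; rewrite mulrDr lerD//.
  (* The factor 4 D^2 is absorbed by 4 <= e^3 and D^2 <= y^120 <= y^200 = e^L. *)
  apply: (@le_trans _ _ (expR (2 * m%:R * L) * (expR 3 * expR L *
      expR (- (y^-1 ^+ 2 * y ^+ 138 / (8 * D)))))).
    apply: ler_pM; rewrite ?exprn_ge0 ?mulr_ge0 ?expR_ge0//.
    have -> (t : R) : 2 * (D * (2 * D * t)) = (4 * (D * D)) * t by ring.
    rewrite ler_wpM2r ?expR_ge0//; apply: ler_pM; rewrite ?mulr_ge0//.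
      by apply: le_trans (expR_ge1Dx (3 : R)); rewrite -(natrD _ 1 3).
    rewrite LE; apply: (@le_trans _ _ (y ^+ 60 * y ^+ 60)); first exact: ler_pM.
    by rewrite -exprD ler_weXn2l.
  rewrite -!expRD ler_expR /u; apply: le_trans (rank_exponent y100 _ Ly D_bd m_le).
    by rewrite !addrA.
  by apply: le_trans L8; rewrite ler1n.
apply: le_trans (cross_rank_estimate m L8 c_bd qm0 lqm) _.
rewrite ler_expR /u mulrN -opprD lerN2 mulr_natr mulr2n.
apply: lerD; apply: le_trans m_ge; first by rewrite ler_weXn2l.
by rewrite exprn_ege1.
Qed.

(** * Choice of parameters in terms of x *)

Theorem theorem4p7 (R : realType) (C : R) (hC : baker_harman_constant C)
    (eps : R) (eps_gt0 : 0 < eps) (eps_lt : eps < 1 / 100%:R) :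
  exists x1 : R, forall x : R, x1 < x -> forall l N : nat,
    factorable C l x N ->
    x / (ln x) `^ (C0 C + 100%:R) <= l%:R ->
    l%:R <= x / (ln x) `^ (C0 C + 10%:R) ->
    (rigidity (DFT R N)
       (N%:R / expR (eps ^+ 6 * (ln N%:R) `^ (36%:R / 100%:R))))%:R
      <= N%:R `^ (7%:R * eps).
Proof.
(* [Ha] yields 100 L <= y and 6 L <= eps y; [Hb] and [Hc] bound the logarithmic factors around l by
   y, so that y^199 <= l <= y^201. *)
have [xa Ha] := ln_powR_le_powR 1 (100 + 6 / eps).
have [xb Hb] := ln_powR_le_powR (C0 C + 100%:R) 1.
have [xc Hc] := ln_powR_le_powR (- (C0 C + 10%:R)) 1.
exists (Num.max (expR 8) (Num.max xa (Num.max xb xc))) => x.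
rewrite !gt_max => /and4P[x8 /Ha {}Ha /Hb {}Hb /Hc {}Hc] l N [qs [uqs szqs good NE]] l_ge l_le.
have x0 : 0 < x by apply: lt_trans x8; apply: expR_gt0.
set L := ln x in Ha Hb Hc l_ge l_le.
have L8 : 8 <= L by rewrite -[leLHS]expRK /L ler_ln ?posrE ?expR_gt0// ltW.
have L0 : 0 < L by apply: lt_le_trans L8.
have xE : x = expR L by rewrite /L lnK.
set y := x `^ 200%:R^-1 in Ha Hb Hc.
have y0 : 0 < y by apply: powR_gt0.
have xy : x = y ^+ 200.
  rewrite -powR_mulrn ?(ltW y0)// /y -powRrM mulVf ?pnatr_eq0//. by rewrite powRr1// ltW.
rewrite powRr1 ?(ltW L0)// in Ha; rewrite mul1r in Hb; rewrite mul1r in Hc.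
have e6 : 0 <= 6 / eps by rewrite divr_ge0// ltW.
have Ly : 100 * L <= y by apply: le_trans Ha; rewrite ler_wpM2r ?(ltW L0)// lerDl.
have epsLy : 6 * L <= eps * y.
  have : 6 / eps * L <= y by apply: le_trans Ha; rewrite ler_wpM2r ?(ltW L0)// lerDr.
  by rewrite mulrAC ler_pdivrMr// mulrC [y * _]mulrC.
have y100 : 100 <= y by lra.
have y1 : 1 <= y by lra.
have y2 : 2 <= y by lra.
have Ly1 : L <= y by lra.
have yX n : 0 < y ^+ n by rewrite exprn_gt0.
have l_ge' : y ^+ 199 <= l%:R.
  apply: le_trans l_ge; rewrite ler_pdivlMr ?powR_gt0// xy [y ^+ 200]exprSr.
  by rewrite ler_wpM2l// ltW.
have l_le' : l%:R <= y ^+ 201.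
  apply: le_trans l_le _; rewrite -powRN xy [y ^+ 201]exprSr.
  by rewrite ler_wpM2l// ltW.
have l1 : 1 <= l%:R :> R by apply: le_trans l_ge'; rewrite exprn_ege1.
have l2 : l.+1%:R <= 2 * l%:R :> R.
  by rewrite -natr1 mulr_natl mulr2n lerD2l.
have x1 : 1 <= x by rewrite xy exprn_ege1.
have N0 : (0 < N)%N.
  rewrite NE big_seq; apply: prodn_cond_gt0 => q /good[/prime_gt0].
  by [].
set n := ln N%:R : R.
have n_le : n <= l%:R * L.
  rewrite /n -[l%:R * L]expRK expRM_natl -xE ler_ln ?posrE ?ltr0n// ?exprn_gt0//.
  rewrite NE -szqs; elim: (qs) good => [|q s IH] H; first by rewrite big_nil expr0.
  rewrite big_cons natrM exprS ler_pM//; first by have [] := H q (mem_head _ _).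
  by apply: IH => q' q'in; apply: H; rewrite inE q'in orbT.
have n_ge : l%:R <= 2 * n.
  have : ln (2 ^+ l) <= n.
    rewrite ler_ln ?posrE ?exprn_gt0 ?ltr0n// -natrX ler_nat NE -szqs.
    apply: pow2_size_le; apply/allP => q /good[/prime_gt1].
    by [].
  rewrite lnXn// -[ln 2 *+ _]mulr_natl -ler_pdivrMl// => /(le_trans _); apply.
  by rewrite mulrC ler_wpM2l// -[leLHS]mul1r ln2_ge_half.
have n_le' : n <= y ^+ 202.
  apply: le_trans n_le _; by rewrite [y ^+ 202]exprSr ler_pM ?(ltW L0).
have n0 : 0 <= n by rewrite ln_ge0// ler1n.
(* In powers of x: D is about x^0.3, the bound on prime powers, and m about x^0.37. Below, eta = 1/y
   = x^(-0.005) and Th = y^138 = x^0.69. *)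
pose D := Num.truncn (y ^+ 60).
have D_le : D%:R <= y ^+ 60 by rewrite truncn_le ltW.
have D_ge : 1 <= D%:R :> R by rewrite ler1n truncn_gt0 exprn_ege1.
pose m := (Num.truncn (y ^+ 74)).+1.
have m_ge : y ^+ 74 <= m%:R by apply/ltW/truncnS_gt.
have m_le : m%:R <= 2 * y ^+ 74 by rewrite truncnS_le_double// exprn_ege1.
pose qm := x / L `^ C0 C.
have qm0 : 0 < qm by rewrite divr_gt0 ?powR_gt0.
have eta01 : 0 < y^-1 <= 1 by rewrite invr_gt0 y0 invf_le1.
have DTh : D%:R <= y^-1 * y ^+ 138.
  by rewrite [y ^+ 138]exprS mulKf ?gt_eqF// (le_trans D_le)// ler_weXn2l.
have x2E : expR (2 * L) = y ^+ 400.
  by rewrite expRM_natl -xE xy -exprM.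
have lnTD : ln ((Num.truncn (2 * ln N%:R : R))%:R * D%:R) <= 2 * L.
  (* If the product is 0, its logarithm is at most 0; otherwise it is at most y^203 y^60 <= y^400 =
     e^(2L). *)
  have [TD0|TD0] := leP ((Num.truncn (2 * ln N%:R : R))%:R * D%:R) (0 : R).
    by apply: (@le_trans _ _ 0); [apply: ln_le0; apply: le_trans TD0 _|rewrite mulr_ge0// ltW].
  rewrite -[leRHS]expRK ler_ln ?posrE ?expR_gt0// x2E.
  apply: (@le_trans _ _ (y ^+ 203 * y ^+ 60)); last by rewrite -exprD ler_weXn2l.
  apply: ler_pM => //; apply: (@le_trans _ _ (2 * n)).
    by rewrite truncn_le mulr_ge0.
  by rewrite [y ^+ 203]exprS ler_pM.
have Hq q : q \in qs -> [/\ prime q, qm <= q%:R <= x & all (geq D) (prime_powers q.-1)].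
  move=> /good[pq qlo qhi pp]; split=> //; first by rewrite /qm qlo.
  apply/allP => _ /mapP[p pP ->] /=.
  rewrite truncn_ge_nat ?(ltW (yX 60))//; rewrite -subn1 in pP *.
  have -> : y ^+ 60 = x `^ (3%:R / 10%:R).
    by rewrite -powR_mulrn ?(ltW y0)// /y -powRrM; congr (_ `^ _); field.
  apply: pp; first by move: pP; rewrite mem_primes => /andP[].
    by rewrite logn_gt0.
  exact: pfactor_dvdnn.
have wP := @dft_root_primitive R.
have Th0 : 0 <= y ^+ 138 by rewrite ltW.
have Lam0 : 0 <= 2 * L by rewrite mulr_ge0// ltW.
have main := slr_dft_smooth wP m qm0 x1 eta01 Th0 Lam0 DTh.
have {main} := main _ _ Hq; rewrite -NE => /(_ lnTD) main.
have qs_cop : pairwise coprime qs.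
  move: uqs; rewrite uniq_pairwise.
  apply: (@sub_in_pairwise _ (fun q => q \in qs)); last exact/allP.
  by move=> p r /good[pp _ _ _] /good[pr _ _ _] /= pr'; rewrite prime_coprime// dvdn_prime2.
have qs_pos : all (leq 1) qs by apply/allP => q /good[/prime_gt0].
have l_exp : (size qs).+1%:R ^+ m <= expR (2 * m%:R * L).
  have -> : 2 * m%:R * L = m%:R * (2 * L) by ring.
  rewrite expRM_natl x2E lerXn2r ?nnegrE ?(ltW (yX _))// szqs.
  apply: (@le_trans _ _ (y ^+ 202)); last by rewrite ler_weXn2l.
  by apply: (le_trans l2); rewrite [y ^+ 202]exprS ler_pM.
have NexpR (t : R) : N%:R `^ t = expR (t * n) by rewrite /powR gt_eqF// ltr0n.
apply: (@le_trans _ _ ((size qs).+1%:R ^+ m *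
  (expR (2 * (D%:R * (1 + y ^+ 138 * (2 * L)) + 6 * y^-1 * (2 * L) * n)) * x ^+ m))); last first.
  (* The factor (l+1)^m costs 2 m L in the exponent and x^m costs m L: together the 3 m L of
     [sparsity_exponent]. *)
  rewrite NexpR; apply: le_trans (ler_wpM2r _ l_exp) _.
    by rewrite mulr_ge0 ?expR_ge0 ?exprn_ge0 ?(ltW x0).
  rewrite xE -expRM_natl -!expRD ler_expR.
  apply: le_trans (sparsity_exponent (m := m%:R) (D := D%:R) y100 _ epsLy _ _ _).
  - by rewrite le_eqVlt; apply/orP; left; apply/eqP; ring.
  - by apply: le_trans L8; rewrite ler1n.
  - exact: le_trans n_ge.
  - by rewrite D_le andbT.
  - by rewrite m_le andbT.
apply: rigidity_le_slr; last first.
- apply: slr_emb (emb_fourier_prod wP qs_cop qs_pos NE) _ _ main.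
    by rewrite card_tidx card_ord NE.
  apply: mulr_ge0; first exact: exprn_ge0.
  apply: addr_ge0; first by rewrite !mulr_ge0 ?expR_ge0.
  by rewrite exprn_ge0// divr_ge0// ltW.
- rewrite mulrC ler_wpM2l// -expRN.
  (* The exponents C0 + 10 and C0 of the logarithm differ by 10, which is the saving needed for the
     crosses. *)
  have lqm : l%:R / qm <= L ^- 10.
    rewrite ler_pdivrMr//; apply: le_trans l_le _.
    rewrite /qm mulrCA ler_wpM2l ?(ltW x0)// powRD; last by rewrite (gt_eqF L0) /= implybT.
    by rewrite powR_mulrn ?(ltW L0)// invfM mulrC.
  apply: rank_estimate y100 L8 Ly _ _ _ _ _ _ l_exp qm0 lqm; rewrite -?xE//.
  - by rewrite n0.
  - by rewrite eps_gt0/=; apply/ltW/(lt_trans eps_lt); rewrite ltr_pdivrMr// mul1r ltr1n.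
  - by rewrite D_ge.
  - by rewrite m_ge.
  - by rewrite szqs l2 andbT.
by rewrite divr_ge0 ?expR_ge0.
Qed.
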